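(* Let $v\in S_\infty$ and let $1\le p\le k$ be integers. Then $$\mathcal G_v(x)\,\mathcal G_{(1^p)}(x_1,\ldots,x_k)\;=\;\sum_{\gamma}(-1)^{\ell(\gamma)-p}\,\mathcal G_{\mathrm{end}(\gamma)}(x),$$ where the sum is over all Pieri chains $\gamma$ in the $k$-Bruhat order on $S_\infty$ that begin at $v$ and have exactly $p$ marks. This formula has no cancellations (i.e. any two chains $\gamma$ in the sum with the same endpoint contribute with the same sign).
   Context: $S_\infty=\bigcup_n S_n$ under the usual inclusions $S_n\hookrightarrow S_{n+1}$; $\ell(w)$ is the number of inversions of a permutation $w$. Permutations multiply so that $w(a,b)$ is obtained from $w$ by exchanging the values in positions $a$ and $b$. Grothendieck polynomials: on $\mathbb Z[x_1,x_2,\ldots]$ let $s_i$ act by interchanging $x_i$ and $x_{i+1}$, let $\partial_i f=(f-s_if)/(x_i-x_{i+1})$ and $\pi_i f=\partial_i\big((1-x_{i+1})f\big)=f+(1-x_i)\partial_i f$. Set $\mathcal G_{\omega_0}(x)=x_1^{n-1}x_2^{n-2}\cdots x_{n-1}$ for $\omega_0=n\cdots21$ the longest element of $S_n$, and $\mathcal G_{ws_i}(x)=\pi_i\mathcal G_w(x)$ whenever $\ell(ws_i)=\ell(w)-1$, where in $ws_i$ the symbol $s_i$ is the transposition $(i,i+1)$. These are well defined and independent of $n$, so $\mathcal G_w(x)$ is defined for $w\in S_\infty$; they form a basis of $\mathbb Z[x_1,x_2,\ldots]$. For $1\le p\le k$, $\mathcal G_{(1^p)}(x_1,\ldots,x_k):=\mathcal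 G_{c_{[k,p]}}(x)$, where $c_{[k,p]}$ is the cycle $(k-p+1,k-p+2,\ldots,k+1)$, i.e. the permutation with $c(i)=i+1$ for $k-p+1\le i\le k$, $c(k+1)=k-p+1$, and $c(i)=i$ otherwise. The $k$-Bruhat order is the suborder of the Bruhat order on $S_\infty$ whose covers are $u\lessdot u(a,b)$ with $a\le k<b$ and $\ell(u(a,b))=\ell(u)+1$; such a cover is written $u\xrightarrow{(a,b)}u(a,b)$. On pairs of positive integers define $(a,b)\prec(c,d)$ iff $b>d$, or $b=d$ and $a<c$. A marked chain in the $k$-Bruhat order is a saturated chain $\gamma$: $v=v_0\xrightarrow{(a_1,b_1)}v_1\xrightarrow{(a_2,b_2)}\cdots\xrightarrow{(a_q,b_q)}v_q=\mathrm{end}(\gamma)$, $q=\ell(\gamma)$, in the $k$-Bruhat order with some of its covers marked. (Chains with different markings are regarded as different.) A Pieri chain in the $k$-Bruhat order is a marked chain such that: (P1) $b_1\ge b_2\ge\cdots\ge b_q$. (P2) If the $i$th cover is marked, then $a_j\ne a_i$ for all $j<i$. (P3) If the $i$th cover is not marked and $i+1\le q$, then $(a_i,b_i)\prec(a_{i+1},b_{i+1})$. (P4) If $b_1=\cdots=b_r$ and $a_1>\cdots>a_r$ for some $r\ge1$, then the $r$th cover $(a_r,b_r)$ is marked. *)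

(* Defs.v *)
(* Positions and values of permutations, and indices of variables, are counted
   from 0: the natural number i stands for the positive integer i + 1.  Hence
   "a <= k < b" for positive integers becomes a < k <= b here. *)
From mathcomp Require Import all_boot all_order all_algebra.
From mathcomp Require Import finmap.
From mathcomp Require Import boolp classical_sets functions cardinality fsbigop.
From mathcomp Require Import monalg.

Set Implicit Arguments.
Unset Strict Implicit.
Unset Printing Implicit Defensive.

Import GRing.Theory.

Local Open Scope classical_set_scope.
Local Open Scope ring_scope.

(* The union of the S_n.  By function and proof extensionality, equality in
   Sinf is equality of the underlying functions. *)
Record Sinf := MkSinf {
  Sinf_fun :> nat -> nat;
  _ : bijective Sinf_fun;
  _ : exists n : nat, forall i : nat, (n <= i)%N -> Sinf_fun i = i }.

Definition transp (a b i : nat) : nat :=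
  if i == a then b else if i == b then a else i.

Lemma transpK (a b : nat) : involutive (transp a b).
Proof.
move=> i; rewrite /transp /=.
case: (i =P a) => [->|/eqP ia]; first by rewrite eqxx; case: eqP.
case: (i =P b) => [->|/eqP ib]; first by rewrite eqxx.
by rewrite (negPf ia) (negPf ib).
Qed.

Fact swap_bij (w : Sinf) (a b : nat) : bijective (fun i => w (transp a b i)).
Proof.
case: w => f fbij fsup; apply: (@bij_comp _ _ _ f (transp a b)) => //.
exact: inv_bij (@transpK a b).
Qed.

Fact swap_fin (w : Sinf) (a b : nat) :
  exists n : nat, forall i : nat, (n <= i)%N -> w (transp a b i) = i.
Proof.
case: w => f fbij [n fn]; exists (maxn n (maxn a b).+1) => i.
rewrite geq_max => /andP[ni]; rewrite gtn_max => /andP[ai bi].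
by rewrite /transp /= !gtn_eqF //= fn.
Qed.

(* The product w(a,b): the values in positions a and b are exchanged. *)
Definition swap (w : Sinf) (a b : nat) : Sinf :=
  MkSinf (swap_bij w a b) (swap_fin w a b).

Definition inversions (w : Sinf) : set (nat * nat) :=
  [set ij | (ij.1 < ij.2)%N /\ (w ij.2 < w ij.1)%N].

(* The set of inversions is finite, so this is its cardinality. *)
Definition ell (w : Sinf) : nat := #|` fset_set (inversions w)|%fset.

Definition longest_fun (n i : nat) : nat := if (i < n)%N then (n.-1 - i)%N else i.

Fact longest_bij (n : nat) : bijective (longest_fun n).
Proof.
apply: inv_bij => i; rewrite /longest_fun.
case: (ltnP i n) => [lt_in|]; last by rewrite ltnNge => ->.
have lt_in1 : (i <= n.-1)%N by case: n lt_in.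
have -> : (n.-1 - i < n)%N.
  by case: n lt_in {lt_in1} => // n _; rewrite ltnS leq_subr.
by rewrite subKn.
Qed.

Fact longest_fin (n : nat) :
  exists m : nat, forall i : nat, (m <= i)%N -> longest_fun n i = i.
Proof. by exists n => i; rewrite /longest_fun ltnNge => ->. Qed.

Definition longest (n : nat) : Sinf := MkSinf (longest_bij n) (longest_fin n).

(* The cycle (k-p+1, ..., k+1), on positions counted from 0. *)
Definition cyc_fun (k p i : nat) : nat :=
  if (k - p <= i < k)%N then i.+1 else if i == k then (k - p)%N else i.

Fact cyc_bij (k p : nat) : bijective (cyc_fun k p).
Proof.
pose g i := if (k - p < i <= k)%N then i.-1 else if i == (k - p)%N then k else i.
have le_pk : (k - p <= k)%N by exact: leq_subr.
exists g; rewrite /g /cyc_fun; move: (k - p)%N le_pk => m le_mk i.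
  case: (boolP (m <= i < k)%N) => [/andP[mi ik]|h]; first by rewrite ltnS mi ik.
  case: (i =P k) => [->|/eqP ik]; first by rewrite ltnn eqxx.
  have -> : (m < i <= k)%N = false.
    apply/negP => /andP[mi ki]; case/negP: h.
    by rewrite (ltnW mi) ltn_neqAle ik ki.
  case: (i =P m) => // im; case/negP: h.
  by rewrite im leqnn ltn_neqAle -{1}im ik le_mk.
case: (boolP (m < i <= k)%N) => [/andP[mi ik]|h].
  case: i mi ik => // i /=; rewrite ltnS => mi ik; by rewrite mi ik.
case: (i =P m) => [->|/eqP im]; first by rewrite ltnn andbF eqxx.
have -> : (m <= i < k)%N = false.
  apply/negP => /andP[mi ki]; case/negP: h.
  by rewrite (ltnW ki) andbT ltn_neqAle eq_sym im mi.
case: (i =P k) => // ik; case/negP: h.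
by rewrite ik leqnn andbT ltn_neqAle le_mk andbT -ik eq_sym.
Qed.

Fact cyc_fin (k p : nat) :
  exists n : nat, forall i : nat, (n <= i)%N -> cyc_fun k p i = i.
Proof.
exists k.+1 => i ki; rewrite /cyc_fun gtn_eqF //.
by rewrite (ltnNge i) (ltnW ki) andbF.
Qed.

Definition cyc (k p : nat) : Sinf := MkSinf (cyc_bij k p) (cyc_fin k p).

(* Z[x_1, x_2, ...] *)
Notation Zpoly := {malg int[{cmonom nat}]}.

Definition x_ (i : nat) : Zpoly := << ucm i >>.

(* Interchanges x_ i and x_ i.+1: every x_j is replaced by its image. *)
Definition s_ (i : nat) (f : Zpoly) : Zpoly :=
  mmap (@malgC {cmonom nat} int)
    (fun m : {cmonom nat} =>
       \prod_(j <- finsupp m) (x_ (transp i i.+1 j)) ^+ m j) f.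

(* The quotient of f - s_i f by x_i - x_{i+1}, which exists and is unique. *)
Definition ddiff (i : nat) (f : Zpoly) : Zpoly :=
  xget 0 [set g : Zpoly | (x_ i - x_ i.+1) * g = f - s_ i f].

Definition isob (i : nat) (f : Zpoly) : Zpoly := ddiff i ((1 - x_ i.+1) * f).

Inductive Groth_graph : Sinf -> Zpoly -> Prop :=
| Groth_longest (n : nat) :
    Groth_graph (longest n) (\prod_(i < n) x_ i ^+ (n.-1 - i))
| Groth_descent (w : Sinf) (i : nat) (f : Zpoly) :
    Groth_graph w f -> ell w = (ell (swap w i i.+1)).+1 ->
    Groth_graph (swap w i i.+1) (isob i f).

(* Groth_graph is the graph of a function, so the choice made by xget is
   immaterial. *)
Definition Groth (w : Sinf) : Zpoly := xget 0 (Groth_graph w).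

Definition Groth_1p (p k : nat) : Zpoly := Groth (cyc k p).

Definition kcover (k : nat) (u : Sinf) (a b : nat) : Prop :=
  (a < k <= b)%N /\ ell (swap u a b) = (ell u).+1.

Definition prec (x y : nat * nat) : bool :=
  (y.2 < x.2)%N || ((x.2 == y.2) && (x.1 < y.1)%N).

(* A marked chain starting at a given permutation is encoded by the list of
   its labels (a_i, b_i), each with its mark.  Since a_i < b_i, the labels
   and the permutations on the chain determine each other. *)
Definition mchain := seq (nat * nat * bool).

Definition lab (g : mchain) (i : nat) : nat * nat := (nth (0, 0, false)%N g i).1.
Definition lab_a (g : mchain) (i : nat) : nat := (lab g i).1.
Definition lab_b (g : mchain) (i : nat) : nat := (lab g i).2.
Definition marked (g : mchain) (i : nat) : bool := (nth (0, 0, false)%N g i).2.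
Definition nmarks (g : mchain) : nat := count (fun c => c.2) g.

Fixpoint is_kchain (k : nat) (v : Sinf) (g : mchain) : Prop :=
  if g is (a, b, _) :: g' then kcover k v a b /\ is_kchain k (swap v a b) g'
  else True.

Fixpoint chain_end (v : Sinf) (g : mchain) : Sinf :=
  if g is (a, b, _) :: g' then chain_end (swap v a b) g' else v.

Definition P1 (g : mchain) : Prop :=
  forall i, (i.+1 < size g)%N -> (lab_b g i.+1 <= lab_b g i)%N.

Definition P2 (g : mchain) : Prop :=
  forall i, (i < size g)%N -> marked g i ->
  forall j, (j < i)%N -> lab_a g j <> lab_a g i.

Definition P3 (g : mchain) : Prop :=
  forall i, (i.+1 < size g)%N -> ~~ marked g i -> prec (lab g i) (lab g i.+1).

(* r counts covers from 0, so it ranges over r < size g and the covers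
   involved are those of index at most r. *)
Definition P4 (g : mchain) : Prop :=
  forall r, (r < size g)%N ->
  (forall i, (i <= r)%N -> lab_b g i = lab_b g 0) ->
  (forall i, (i < r)%N -> (lab_a g i.+1 < lab_a g i)%N) ->
  marked g r.

Definition Pieri_chain (k : nat) (v : Sinf) (g : mchain) : Prop :=
  is_kchain k v g /\ [/\ P1 g, P2 g, P3 g & P4 g].

Definition Pieri_chains (k p : nat) (v : Sinf) : set mchain :=
  [set g | Pieri_chain k v g /\ nmarks g = p].

(* Main.v *)
Require Import Defs.
From HB Require Import structures.
From mathcomp Require Import all_boot all_order all_algebra.
From mathcomp Require Import finmap.
From mathcomp Require Import boolp classical_sets functions cardinality fsbigop.
From mathcomp Require Import monalg.
From mathcomp Require Import ring zify.

Set Implicit Arguments.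
Unset Strict Implicit.
Unset Printing Implicit Defensive.

Import GRing.Theory.

Local Open Scope classical_set_scope.
Local Open Scope ring_scope.

(** Fix k and write G_w for the Grothendieck polynomial of w, and y_i = 1 - x_i.
Let X_p(v) be the signed sum of the G_end over all marked chains from v with p
marks that satisfy (P1), (P2) and (P3), and let A_p(v) be the part of that sum
in which (P4) holds as well.  The theorem says A_p(v) = G_v G_(1^p).

Reduction to X_p.  In a chain satisfying (P3), all covers of the longest initial run
b_1 = ... = b_r, a_1 > ... > a_r, except possibly the last one, are marked, and
both markings of that last cover are possible.  Changing its mark matches the
chains with p marks that violate (P4) with those with p + 1 marks that satisfy
it, so X_p = A_p - A_(p+1) (chain_sum_run_marked).  The heart of the proof is
the product formula X_p(v) = e_p G_v, where e_p is the coefficient of t^p in the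
product of the y_i + t x_i over i < k (pieri_Groth).  Since X_p vanishes for
large p, the two facts determine A_p: A_p(v) = G_v A_p(1), where 1 is the identity
permutation.  From the identity there is exactly one chain with p marks that satisfies (P4), and it ends at the
cycle c_[k,p] (run_marked_sum_id); so A_p(1) = G_(1^p) and the theorem follows.

The product formula.  A chain is read label by label; what can follow depends
on the permutation w reached, on the set S of rows already used and on the next
admissible label (a, b).  This gives a recursion for the sum over the remaining
chains.  Within one column b the recursion can be inverted: uncolumn recovers
the sum at the end of the column from the sums at its beginning, and it is
injective (uncolumn_inj).  An identity between sums that start at column b may
therefore be checked after uncolumn has been applied, where it becomes the same
identity for the next column.  This is used twice.

 - The sums commute with exchanging two adjacent rows i, i+1 < k that form a
   descent, hence with the operator pi_i (chain_sum_sort).  As pi_i maps G_w to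
   G_(w s_i) at a descent and e_p is symmetric in x_i, x_(i+1), it is enough to
   treat a v that is decreasing on the first k positions.

 - For such v, induct on k.  The last row holds the smallest value, so it is
   never in the way of the other rows.  The covers in that row can be
   performed after all others, and they act by a signed sum over chains in a
   single row (chain_sum_split).  On Grothendieck polynomials this signed sum
   is multiplication by y_k (row_op_mul), which turns the formula for k rows
   into the one for k + 1 rows.

The statement row_op_mul is a case of the transition formula.  It is
proved by descending from the longest element, where multiplication by x_k just
multiplies monomials: commutation with pi_i handles all i except k, and at
i = k the relation pi_k (y_(k+1) f) = y_(k+1) f + y_k pi_k f moves from row
k + 1 to row k. *)

(** * The polynomial ring and the operators on it *)
Definition xsubst (i : nat) (m : {cmonom nat}) : Zpoly :=
  \prod_(j <- finsupp m) (x_ (transp i i.+1 j)) ^+ m j.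

Lemma xsubstE i (m : {cmonom nat}) (d : {fset nat}) :
  (finsupp m `<=` d)%fset ->
  xsubst i m = \prod_(j <- d) (x_ (transp i i.+1 j)) ^+ m j.
Proof.
move=> /fsubsetP md; rewrite /xsubst (big_fset_incl _ (B := d)) //.
  exact/fsubsetP.
by move=> j jd; rewrite -cmE_eq0 => /eqP ->.
Qed.

Lemma xsubst_morph i : mmorphism (xsubst i).
Proof.
split => [m1 m2|]; last by rewrite /xsubst mdom1 big_seq_fset0.
rewrite (@xsubstE i m1 (finsupp m1 `|` finsupp m2)%fset) ?fsubsetUl //.
rewrite (@xsubstE i m2 (finsupp m1 `|` finsupp m2)%fset) ?fsubsetUr //.
rewrite /xsubst mdomD -big_split /=; apply: eq_bigr => j _.
by rewrite cmM exprD.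
Qed.

(* By definition s_ i is the extension to polynomials of the monoid morphism
   xsubst i, so it is a ring morphism. *)
HB.instance Definition _ i := isMultiplicative.Build _ _ (xsubst i) (xsubst_morph i).
HB.instance Definition _ i := GRing.Additive.copy (s_ i) (mmap (@malgC {cmonom nat} int) (xsubst i)).
HB.instance Definition _ i := GRing.RMorphism.copy (s_ i) (mmap (@malgC {cmonom nat} int) (xsubst i)).

Lemma s_E i : s_ i = mmap (@malgC {cmonom nat} int) (xsubst i).
Proof. by []. Qed.

Lemma s_C i (c : int) : s_ i c%:MP = c%:MP.
Proof. by rewrite s_E mmapC. Qed.

Lemma s_x i j : s_ i (x_ j) = x_ (transp i i.+1 j).
Proof.
rewrite s_E mmapU /xsubst mdomU big_seq_fset1 cmUU expr1; exact: mul1r.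
Qed.

Lemma ucm_factor (m : {cmonom nat}) (j : nat) : (0 < m j)%N ->
  exists m' : {cmonom nat}, m = mmul (ucm j) m'.
Proof.
move=> mj; exists (divcm m (ucm j)); apply/eqP/cmP => i.
rewrite cmM divcmE cmU; case: (j =P i) => [<-|_]; last by rewrite subn0.
by rewrite subnKC.
Qed.

Lemma malgUM (m1 m2 : {cmonom nat}) : << mmul m1 m2 >> = << m1 >> * << m2 >> :> Zpoly.
Proof. by rewrite malgM_def fgmulUU mul1r. Qed.

Lemma malgU1 : << mone >> = 1 :> Zpoly.
Proof. by []. Qed.

(** Polynomial identities preserved by sums and products need only be checked on
    constants and variables. *)
Lemma Zpoly_ind (P : Zpoly -> Prop) :
  (forall c : int, P c%:MP) -> (forall j, P (x_ j)) ->
  (forall f g, P f -> P g -> P (f + g)) ->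
  (forall f g, P f -> P g -> P (f * g)) -> forall f, P f.
Proof.
move=> PC Px PD PM f; rewrite (monalgE f).
have P0 : P 0 by rewrite -malgC0E.
have P1 : P 1 by rewrite -mpolyC1E.
elim: (enum_fset _) => [|m s IH]; first by rewrite big_nil.
rewrite big_cons; apply: (PD _ _ _ IH).
have -> : << f@_m *g m >> = (f@_m)%:MP * << m >> :> Zpoly.
  by rewrite malgM_def fgmulUU mulr1 mul1m.
apply: (PM _ _ (PC _)).
move: {2}(mdeg m) (leqnn (mdeg m)) => n; elim: n m {IH} => [|n IH] m.
  by rewrite leqn0 mdeg_eq0 => /eqP ->; rewrite malgU1.
have [->|m1] := eqVneq m mone; first by rewrite malgU1.
have : finsupp m != fset0.
  apply: contra m1 => /eqP fm; apply/cmP => i.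
  by rewrite cm1; apply/eqP; rewrite cmE_eq0 fm in_fset0.
case/fset0Pn => j; rewrite -cmE_neq0 -lt0n => /ucm_factor[m' ->].
rewrite mdegM mdegU add1n ltnS => /IH Pm'.
by rewrite malgUM; apply: (PM _ _ (Px _) Pm').
Qed.

Lemma mcoeffUM (k m : {cmonom nat}) (g : Zpoly) : (<< k >> * g)@_(mmul k m) = g@_m.
Proof.
rewrite malgM_def fgmulUg raddf_sum /=.
rewrite [in RHS](monalgE g) raddf_sum /=; apply: eq_bigr => m' _.
rewrite !mcoeffU mul1r; congr (_ *+ (_ : bool)).
apply/eqP/eqP => [km|-> //]; apply/eqP/cmP => i.
by have /(congr1 (fun h : {cmonom nat} => h i)) := km; rewrite !cmM => /addnI.
Qed.

Lemma mcoeffxM_eq0 (j : nat) (m : {cmonom nat}) (g : Zpoly) :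
  m j = 0%N -> (x_ j * g)@_m = 0.
Proof.
move=> mj; rewrite malgM_def fgmulUg raddf_sum /=.
rewrite big1 // => m' _; rewrite mcoeffU.
case: eqP => // /(congr1 (fun h : {cmonom nat} => h j)).
by rewrite cmM cmUU mj.
Qed.

(** From x_i g = x_j g every coefficient of g equals the one at the monomial with one
    factor x_j replaced by x_i; after finitely many replacements there is no
    factor x_j left, and such a coefficient of x_j g vanishes. *)
Lemma xB_reg (i j : nat) (g : Zpoly) : i != j -> (x_ i - x_ j) * g = 0 -> g = 0.
Proof.
move=> ij /eqP; rewrite mulrBl subr_eq0 => /eqP xg.
have {}xg m : g@_m = (x_ j * g)@_(mmul (ucm i) m).
  by rewrite -xg mcoeffUM.
apply/malgP => m; rewrite mcoeff0.
move: {2}(m j) (erefl (m j)) => n; elim: n m => [|n IH] m mj.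
  by rewrite xg mcoeffxM_eq0 // cmM cmU mj (negPf ij).
have m0 : (0 < m j)%N by rewrite mj.
have [m' m'E] := ucm_factor m0.
rewrite xg m'E mulmA (mulmC (ucm i)) -mulmA mcoeffUM IH //.
by move: mj; rewrite m'E !cmM cmUU cmU (negPf ij) => -[].
Qed.

(** All identities between the operators follow from the equation that defines
    (x_i - x_(i+1)) pi_i f, because x_i - x_(i+1) can be cancelled. *)
Section DividedDifferences.

Variables (R : comNzRingType) (x : nat -> R) (s pi : nat -> R -> R).

Local Notation y i := (1 - x i).

Hypothesis sD : forall i, {morph s i : f g / f + g}.
Hypothesis sM : forall i, {morph s i : f g / f * g}.
Hypothesis s1 : forall i, s i 1 = 1.
Hypothesis sK : forall i, involutive (s i).
Hypothesis sx : forall i j, s i (x j) = x (transp i i.+1 j).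
Hypothesis s_far : forall i j f, (i.+1 < j)%N -> s i (s j f) = s j (s i f).
Hypothesis s_braid :
  forall i f, s i (s i.+1 (s i f)) = s i.+1 (s i (s i.+1 f)).
Hypothesis xB_reg : forall i j f, i != j -> (x i - x j) * f = 0 -> f = 0.
Hypothesis piE :
  forall i f, (x i - x i.+1) * pi i f = y i.+1 * f - y i * s i f.

Lemma s0 i : s i 0 = 0.
Proof. by apply: (addrI (s i 0)); rewrite -sD !addr0. Qed.

Lemma sN i : {morph s i : f / - f}.
Proof. by move=> f; apply: (addrI (s i f)); rewrite -sD !subrr s0. Qed.

Lemma sB i : {morph s i : f g / f - g}.
Proof. by move=> f g; rewrite sD sN. Qed.

Lemma sX i n : {morph s i : f / f ^+ n}.
Proof.
by move=> f; elim: n => [|n IH]; rewrite ?expr0 ?s1 // !exprS sM IH.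
Qed.

Lemma sxl i : s i (x i) = x i.+1.
Proof. by rewrite sx /transp eqxx. Qed.

Lemma sxr i : s i (x i.+1) = x i.
Proof. by rewrite -sxl sK. Qed.

Lemma sxo i j : j != i -> j != i.+1 -> s i (x j) = x j.
Proof. by move=> ji ji1; rewrite sx /transp (negPf ji) (negPf ji1). Qed.

Lemma xB_inj i j (f g : R) :
  i != j -> (x i - x j) * f = (x i - x j) * g -> f = g.
Proof.
move=> ij /eqP; rewrite -subr_eq0 -mulrBr => /eqP /(xB_reg ij)/eqP.
by rewrite subr_eq0 => /eqP.
Qed.

Lemma pi_unique i (f g : R) :
  (x i - x i.+1) * g = y i.+1 * f - y i * s i f -> pi i f = g.
Proof. by move=> gE; apply: (@xB_inj i i.+1); rewrite ?piE //; lia. Qed.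

Lemma piD i : {morph pi i : f g / f + g}.
Proof.
by move=> f g; apply: pi_unique; rewrite mulrDr !piE sD; ring.
Qed.

Lemma piM i (c f : R) : s i c = c -> pi i (c * f) = c * pi i f.
Proof. by move=> ci; apply: pi_unique; rewrite mulrCA piE sM ci; ring. Qed.

Lemma piB i : {morph pi i : f g / f - g}.
Proof.
move=> f g; rewrite piD; congr (_ + _).
by rewrite -mulN1r piM ?mulN1r // sN s1.
Qed.

Lemma pi_fixed i (f : R) : s i f = f -> pi i f = f.
Proof. by move=> fi; apply: pi_unique; rewrite fi; ring. Qed.

Lemma s_pi i (f : R) : s i (pi i f) = pi i f.
Proof.
apply/esym/pi_unique; have := congr1 (s i) (piE i f).
rewrite !(sB, sM, s1, sxl, sxr) sK => E.
by rewrite -opprB mulNr E opprB.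
Qed.

Lemma piK i (f : R) : pi i (pi i f) = pi i f.
Proof. exact/pi_fixed/s_pi. Qed.

Lemma pi_yr i (f : R) : pi i (y i.+1 * f) = y i.+1 * f + y i * pi i f.
Proof.
apply: pi_unique; rewrite mulrDr [_ * (y i * _)]mulrCA piE sM sB s1 sxr.
by ring.
Qed.

Lemma pi_x i (c : R) m : s i c = c ->
  pi i (x i ^+ m.+1 * x i.+1 ^+ m * c) = x i ^+ m * x i.+1 ^+ m * c.
Proof.
by move=> ci; apply: pi_unique; rewrite !sM !sX sxl sxr ci !exprS; ring.
Qed.

Lemma pi_far i j (f : R) : (i.+1 < j)%N -> pi i (pi j f) = pi j (pi i f).
Proof.
move=> ij; apply: pi_unique.
have fix_j a : (a == i) || (a == i.+1) -> s j (y a) = y a.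
  by move=> ai; rewrite sB s1 sxo //; lia.
have fix_i a : (a == j) || (a == j.+1) -> s i (y a) = y a.
  by move=> ai; rewrite sB s1 sxo //; lia.
rewrite -piM; last by rewrite !(sB, sM) !sxo //; lia.
rewrite piE piB !piM; try by rewrite fix_j ?eqxx ?orbT.
congr (_ - _ * _); apply: pi_unique.
have := congr1 (s i) (piE j f).
rewrite sB !sM !fix_i ?eqxx ?orbT // sB !(@sxo i); try lia.
by rewrite s_far // => ->.
Qed.

(** Multiplied by (x_i - x_(i+1)) (x_(i+1) - x_(i+2)) (x_i - x_(i+2)), both sides
    become the same combination of the six images of f under the group generated
    by s_i and s_(i+1). *)
Lemma pi_braid i (f : R) :
  pi i (pi i.+1 (pi i f)) = pi i.+1 (pi i (pi i.+1 f)).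
Proof.
have [ni1 ni2 n12] : [/\ i != i.+1, i != i.+2 & i.+1 != i.+2] by split; lia.
apply: (xB_inj ni1); apply: (xB_inj n12); apply: (xB_inj ni2).
have sE : (s i (x i.+2) = x i.+2) * (s i.+1 (x i) = x i).
  by split; apply: sxo; lia.
pose mor := (sB, sM, s1, sxl, sxr, sE).
set a := pi i f; set b := pi i.+1 a; set c := pi i b.
set a' := pi i.+1 f; set b' := pi i a'; set c' := pi i.+1 b'.
(* The images of the defining equations of the inner operators under s_i and
   s_(i+1) express every term that occurs in the expansion. *)
have a1 : (x i - x i.+1) * a = _ := piE i f.
have a2 := congr1 (s i.+1) a1; rewrite !mor in a2.
have a3 := congr1 (s i) a2; rewrite !mor s_braid in a3.
have b1 : (x i.+1 - x i.+2) * b = _ := piE i.+1 a.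
have b2 := congr1 (s i) b1; rewrite !mor s_pi -/a in b2.
have c1 : (x i - x i.+1) * c = _ := piE i b.
have a1' : (x i.+1 - x i.+2) * a' = _ := piE i.+1 f.
have a2' := congr1 (s i) a1'; rewrite !mor in a2'.
have a3' := congr1 (s i.+1) a2'; rewrite !mor in a3'.
have b1' : (x i - x i.+1) * b' = _ := piE i a'.
have b2' := congr1 (s i.+1) b1'; rewrite !mor s_pi -/a' in b2'.
have c1' : (x i.+1 - x i.+2) * c' = _ := piE i.+1 b'.
move: (x i) (x i.+1) (x i.+2) a1 a2 a3 b1 b2 c1 a1' a2' a3' b1' b2' c1'.
move=> X Y Z a1 a2 a3 b1 b2 c1 a1' a2' a3' b1' b2' c1'.
have -> : (X - Z) * ((Y - Z) * ((X - Y) * c)) =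
  (1 - Z) * (1 - Z) * (1 - Y) * f - (1 - Z) * (1 - Z) * (1 - X) * s i f
  - (1 - Y) * (1 - Y) * (1 - Z) * s i.+1 f
  + (1 - Y) * (1 - Y) * (1 - X) * s i.+1 (s i f)
  + (1 - X) * (1 - X) * (1 - Z) * s i (s i.+1 f)
  - (1 - X) * (1 - X) * (1 - Y) * s i.+1 (s i (s i.+1 f)).
  rewrite c1; transitivity ((1 - Y) * (X - Z) * ((Y - Z) * b)
    - (1 - X) * (Y - Z) * ((X - Z) * s i b)); first by ring.
  rewrite b1 b2; transitivity ((1 - Z) * (1 - Z) * ((X - Y) * a)
    - (1 - Y) * (1 - Y) * ((X - Z) * s i.+1 a)
    + (1 - X) * (1 - X) * ((Y - Z) * s i (s i.+1 a))); first by ring.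
  by rewrite a1 a2 a3; ring.
transitivity ((X - Z) * ((X - Y) * ((Y - Z) * c'))); last by ring.
rewrite c1'; transitivity ((1 - Z) * (X - Z) * ((X - Y) * b')
    - (1 - Y) * (X - Y) * ((X - Z) * s i.+1 b')); last by ring.
rewrite b1' b2'; transitivity ((1 - Y) * (1 - Z) * ((Y - Z) * a')
    - (1 - X) * (1 - Z) * ((X - Z) * s i a')
    + (1 - X) * (1 - Y) * ((X - Y) * s i.+1 (s i a'))); last by ring.
by rewrite a1' a2' a3'; ring.
Qed.

End DividedDifferences.

(* Splits on every test made by transp, innermost first. *)
Ltac case_transp :=
  rewrite /transp;
  repeat match goal with
  | |- context [if (?a == ?b) then _ else _] =>
    lazymatch a with context [if _ then _ else _] => fail | _ =>
    lazymatch b with context [if _ then _ else _] => fail | _ =>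
      case: (a =P b) => ?
    end end
  end.

Lemma transp_far i j h : (i.+1 < j)%N ->
  transp i i.+1 (transp j j.+1 h) = transp j j.+1 (transp i i.+1 h).
Proof. by move=> ij; case_transp; lia. Qed.

Lemma transp_braid i h :
  transp i i.+1 (transp i.+1 i.+2 (transp i i.+1 h)) =
  transp i.+1 i.+2 (transp i i.+1 (transp i.+1 i.+2 h)).
Proof. by case_transp; lia. Qed.

Lemma quotient_mul (R : comNzRingType) (d f g sf sg f' g' : R) :
  d * f' = f - sf -> d * g' = g - sg -> d * (f' * g + sf * g') = f * g - sf * sg.
Proof.
move=> f'E g'E; transitivity (d * f' * g + sf * (d * g')); first by ring.
by rewrite f'E g'E; ring.
Qed.

Lemma quotient_add (R : comNzRingType) (d f g sf sg f' g' : R) :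
  d * f' = f - sf -> d * g' = g - sg -> d * (f' + g') = (f + g) - (sf + sg).
Proof. by move=> f'E g'E; rewrite mulrDr f'E g'E; ring. Qed.

Lemma s_D i : {morph s_ i : f g / f + g}.
Proof. exact: rmorphD. Qed.

Lemma s_M i : {morph s_ i : f g / f * g}.
Proof. exact: rmorphM. Qed.

Lemma s_1 i : s_ i 1 = 1.
Proof. exact: rmorph1. Qed.

Definition ring_hom (phi : Zpoly -> Zpoly) : Prop :=
  [/\ {morph phi : f g / f + g}, {morph phi : f g / f * g}
    & forall c : int, phi c%:MP = c%:MP].

Lemma ring_hom_id : ring_hom id.
Proof. by split. Qed.

Lemma ring_hom_s i : ring_hom (s_ i).
Proof. split; [exact: s_D|exact: s_M|exact: s_C]. Qed.

Lemma ring_hom_comp (phi psi : Zpoly -> Zpoly) :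
  ring_hom phi -> ring_hom psi -> ring_hom (fun f => phi (psi f)).
Proof.
by move=> [aD aM aC] [bD bM bC]; split=> [f g|f g|c];
  rewrite ?bD ?aD ?bM ?aM ?bC ?aC.
Qed.

(** Two words in the s_i agree as soon as they agree on variables, where they act
    through transpositions. *)
Lemma ring_hom_ext (phi psi : Zpoly -> Zpoly) :
  ring_hom phi -> ring_hom psi -> (forall j, phi (x_ j) = psi (x_ j)) ->
  forall f, phi f = psi f.
Proof.
move=> [aD aM aC] [bD bM bC] xE; apply: Zpoly_ind => [c|//|f g fE gE|f g fE gE].
- by rewrite aC bC.
- by rewrite aD bD fE gE.
- by rewrite aM bM fE gE.
Qed.

Lemma s_xx i j h :
  s_ i (s_ j (x_ h)) = x_ (transp i i.+1 (transp j j.+1 h)).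
Proof. exact: etrans (congr1 (s_ i) (s_x j h)) (s_x i _). Qed.

Lemma s_xxx i j l h :
  s_ i (s_ j (s_ l (x_ h))) =
  x_ (transp i i.+1 (transp j j.+1 (transp l l.+1 h))).
Proof. exact: etrans (congr1 (s_ i) (s_xx j l h)) (s_x i _). Qed.

Lemma s_K i : involutive (s_ i).
Proof.
apply: (ring_hom_ext (ring_hom_comp (ring_hom_s i) (ring_hom_s i)) ring_hom_id).
by move=> j; apply: etrans (s_xx i i j) _; rewrite transpK.
Qed.

Lemma s_s_far i j (f : Zpoly) : (i.+1 < j)%N -> s_ i (s_ j f) = s_ j (s_ i f).
Proof.
move=> ij; move: f; apply: ring_hom_ext => [||h].
- exact: ring_hom_comp (ring_hom_s i) (ring_hom_s j).
- exact: ring_hom_comp (ring_hom_s j) (ring_hom_s i).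
- by apply: etrans (s_xx i j h) (etrans _ (esym (s_xx j i h))); rewrite transp_far.
Qed.

Lemma s_s_braid i (f : Zpoly) :
  s_ i (s_ i.+1 (s_ i f)) = s_ i.+1 (s_ i (s_ i.+1 f)).
Proof.
have hom a b : ring_hom (fun f => s_ a (s_ b (s_ a f))).
  apply: (ring_hom_comp (ring_hom_s a)).
  exact: ring_hom_comp (ring_hom_s b) (ring_hom_s a).
move: f; apply: ring_hom_ext (hom _ _) (hom _ _) _ => h.
apply: etrans (s_xxx _ _ _ h) (etrans _ (esym (s_xxx _ _ _ h))).
by rewrite transp_braid.
Qed.

(** The quotients for f g and f + g are built from those for f and g (Leibniz rule). *)
Lemma ddiff_ex i (f : Zpoly) : exists g, (x_ i - x_ i.+1) * g = f - s_ i f.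
Proof.
elim/Zpoly_ind: f => [c|j|f g [f' f'E] [g' g'E]|f g [f' f'E] [g' g'E]].
- by exists 0; rewrite s_C mulr0 subrr.
- rewrite s_x /transp; case: eqP => [->|_]; first by exists 1; rewrite mulr1.
  case: eqP => [->|_]; last by exists 0; rewrite mulr0 subrr.
  by exists (-1); rewrite mulrN1 opprB.
- by exists (f' + g'); rewrite s_D; apply: quotient_add f'E g'E.
- by exists (f' * g + s_ i f * g'); rewrite s_M; apply: quotient_mul f'E g'E.
Qed.

Lemma ddiffE i (f : Zpoly) : (x_ i - x_ i.+1) * ddiff i f = f - s_ i f.
Proof.
rewrite /ddiff; case: xgetP => [g _ gE|noq]; first exact: gE.
by have [g /noq] := ddiff_ex i f.
Qed.

Lemma isobE i (f : Zpoly) :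
  (x_ i - x_ i.+1) * isob i f = (1 - x_ i.+1) * f - (1 - x_ i) * s_ i f.
Proof.
apply: etrans (ddiffE _ _) _; congr (_ - _).
rewrite s_M; congr (_ * _); rewrite rmorphB; congr (_ - _); first exact: s_1.
by apply: etrans (s_x i _) _; congr (x_ _); case_transp; lia.
Qed.

Lemma isobB i : {morph isob i : f g / f - g}.
Proof. exact: piB s_D s_M s_1 xB_reg isobE i. Qed.

Lemma isobM i (c f : Zpoly) : s_ i c = c -> isob i (c * f) = c * isob i f.
Proof. exact: piM s_M xB_reg isobE i c f. Qed.

Lemma isobK i (f : Zpoly) : isob i (isob i f) = isob i f.
Proof. exact: piK s_D s_M s_1 s_K s_x xB_reg isobE i f. Qed.

Lemma isob_yr i (f : Zpoly) :
  isob i ((1 - x_ i.+1) * f) = (1 - x_ i.+1) * f + (1 - x_ i) * isob i f.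
Proof. exact: pi_yr s_D s_M s_1 s_K s_x xB_reg isobE i f. Qed.

Lemma isob_x i (c : Zpoly) m : s_ i c = c ->
  isob i (x_ i ^+ m.+1 * x_ i.+1 ^+ m * c) = x_ i ^+ m * x_ i.+1 ^+ m * c.
Proof. exact: pi_x s_M s_1 s_K s_x xB_reg isobE i c m. Qed.

Lemma isob_far i j (f : Zpoly) :
  (i.+1 < j)%N -> isob i (isob j f) = isob j (isob i f).
Proof. exact: pi_far s_D s_M s_1 s_x s_s_far xB_reg isobE i j f. Qed.

Lemma isob_braid i (f : Zpoly) :
  isob i (isob i.+1 (isob i f)) = isob i.+1 (isob i (isob i.+1 f)).
Proof. exact: pi_braid s_D s_M s_1 s_K s_x s_s_braid xB_reg isobE i f. Qed.

(** * Permutations, Bruhat covers and length *)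
Lemma Sinf_ext (u v : Sinf) : u =1 v -> u = v.
Proof.
case: u => u ub uf; case: v => v vb vf /= uv.
have {}uv : u = v by apply: funext.
by case: _ / uv in vb vf *; congr MkSinf; apply: Prop_irrelevance.
Qed.

Lemma Sinf_inj (w : Sinf) : injective w.
Proof. by case: w => w wb wf /=; apply: bij_inj. Qed.

Lemma Sinf_bound (w : Sinf) : exists n, forall i, (n <= i)%N -> w i = i.
Proof. by case: w. Qed.

Definition fixes_from (n : nat) (w : Sinf) : Prop := forall i, (n <= i)%N -> w i = i.

Lemma fixes_from_le (m n : nat) (w : Sinf) :
  (m <= n)%N -> fixes_from m w -> fixes_from n w.
Proof. by move=> mn wm i ni; apply: wm; apply: leq_trans ni. Qed.

Lemma fixes_lt (n i : nat) (w : Sinf) : fixes_from n w -> (i < n)%N -> (w i < n)%N.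
Proof.
move=> wn i_n; rewrite ltnNge; apply/negP => nwi.
by have /Sinf_inj wi := wn _ nwi; rewrite wi in nwi; lia.
Qed.

Lemma fixes_swap (n a b : nat) (w : Sinf) :
  (a < n)%N -> (b < n)%N -> fixes_from n w -> fixes_from n (swap w a b).
Proof. by move=> an bn wn i ni /=; rewrite wn; case_transp; lia. Qed.

Lemma swapK (w : Sinf) (a b : nat) : swap (swap w a b) a b = w.
Proof. by apply: Sinf_ext => i /=; rewrite transpK. Qed.

Lemma swapl (w : Sinf) (a b : nat) : swap w a b a = w b.
Proof. by rewrite /= /transp eqxx. Qed.

Lemma swapr (w : Sinf) (a b : nat) : swap w a b b = w a.
Proof. by rewrite /=; congr (w _); case_transp; lia. Qed.

Lemma swapo (w : Sinf) (a b i : nat) : i != a -> i != b -> swap w a b i = w i.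
Proof. by move=> ia ib; rewrite /=; congr (w _); case_transp; lia. Qed.

(** The covers of the Bruhat order, in a form that can be decided (see ell_cov) *)
Definition cov (w : Sinf) (a b : nat) : bool :=
  [&& (a < b)%N, (w a < w b)%N
    & all (fun c => ~~ (w a < w c < w b)%N) (iota a.+1 (b - a.+1))].

Lemma covP (w : Sinf) (a b : nat) :
  reflect [/\ (a < b)%N, (w a < w b)%N
            & forall c, (a < c < b)%N -> ~~ (w a < w c < w b)%N] (cov w a b).
Proof.
apply: (iffP and3P) => -[ab wab] h; split => //; last first.
  by apply/allP => c; rewrite mem_iota => cab; apply: h; lia.
by move=> c cab; apply: (allP h); rewrite mem_iota; lia.
Qed.

Lemma ellE (w : Sinf) (n : nat) : fixes_from n w ->
  ell w = (\sum_(0 <= i < n) \sum_(0 <= j < n) ((i < j) && (w j < w i)))%N.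
Proof.
move=> wn; pose s := [seq ij <- [seq (i, j) | i <- iota 0 n, j <- iota 0 n]
  | (ij.1 < ij.2)%N && (w ij.2 < w ij.1)%N].
have sE : inversions w = [set` s].
  apply/seteqP; split => -[i j] /=; rewrite mem_filter /=; last first.
    by case/andP => /andP[].
  move=> [/= ij wji]; rewrite ij wji /=; apply/allpairsP.
  have jn : (j < n)%N.
    rewrite ltnNge; apply/negP => nj.
    have := wn _ nj; case: (leqP n i) => [/wn wi|i_n]; first by lia.
    by have := fixes_lt wn i_n; lia.
  by exists (i, j); rewrite !mem_iota; split => //=; lia.
rewrite /ell; have -> : fset_set (inversions w) = [fset x in s]%fset.
  apply/fsetP => x; rewrite in_fset_set; last by rewrite sE; exact: finite_seq.
  by rewrite sE !inE; apply/idP/idP => [|?]; [rewrite inE|rewrite inE].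
rewrite card_fseq undup_id; last first.
  by apply/filter_uniq/allpairs_uniq => [||[? ?] [? ?] _ _ [-> ->]] //; exact: iota_uniq.
rewrite size_filter -sum1_count big_mkcond big_allpairs.
rewrite /index_iota subn0; apply: eq_bigr => i _; apply: eq_bigr => j _ /=.
by case: (_ && _).
Qed.

Lemma perm_transp (n a b : nat) : (a < n)%N -> (b < n)%N ->
  perm_eq (map (transp a b) (iota 0 n)) (iota 0 n).
Proof.
move=> an bn; apply: uniq_perm; rewrite ?iota_uniq //.
  by rewrite map_inj_uniq ?iota_uniq //; apply: inv_inj (transpK a b).
move=> i; rewrite mem_iota; apply/mapP/idP => [[j jn ->]|i_n].
  by move: jn; rewrite mem_iota; case_transp; lia.
exists (transp a b i); rewrite ?transpK // mem_iota.
by case_transp; lia.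
Qed.

Lemma sum_pair (V : zmodType) (s : seq nat) (a b : nat) (g : nat -> V) :
  uniq s -> a \in s -> b \in s -> a != b ->
  \sum_(i <- s) g i = g a + g b + \sum_(i <- s | (i != a) && (i != b)) g i.
Proof.
move=> us sa sb ab; rewrite (bigD1_seq a) //= -addrA; congr (_ + _).
rewrite -big_filter (bigD1_seq b) ?filter_uniq //=; last first.
  by rewrite mem_filter sb eq_sym ab.
by rewrite big_filter_cond.
Qed.

(** Each position c between a and b whose value lies between w a and w b gives two
    new inversions, with a and with b; the pair (a, b) itself gives one more. *)
Lemma ell_swap (w : Sinf) (n a b : nat) : fixes_from n w -> (b < n)%N ->
  (a < b)%N -> (w a < w b)%N ->
  ell (swap w a b) =
  (ell w + 1 + 2 * \sum_(c <- iota 0 n) ((a < c < b) && (w a < w c < w b)))%N.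
Proof.
move=> wn bn ab wab; have an : (a < n)%N by lia.
pose f i j : int := (w j < w i)%N%:R.
(* After reindexing by the transposition, the two lengths count the same pairs of
   values; only the comparison of positions changes, by D. *)
pose D i j : int := (transp a b i < transp a b j)%N%:R - (i < j)%N%:R.
pose h i j := f i j * D i j.
have E u : fixes_from n u -> (ell u)%:R =
    \sum_(i <- iota 0 n) \sum_(j <- iota 0 n)
      (i < j)%N%:R * (u j < u i)%N%:R :> int.
  move=> /ellE ->; rewrite /index_iota subn0 natr_sum; apply: eq_bigr => i _.
  by rewrite natr_sum; apply: eq_bigr => j _; rewrite -natrM mulnb.
have Ew : (ell (swap w a b))%:R - (ell w)%:R =
    \sum_(i <- iota 0 n) \sum_(j <- iota 0 n) h i j :> int.
  rewrite !E //; last exact: fixes_swap.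
  rewrite -(perm_big _ (perm_transp an bn)) big_map /= -sumrB.
  apply: eq_bigr => i _.
  rewrite -(perm_big _ (perm_transp an bn)) big_map /= -sumrB.
  by apply: eq_bigr => j _; rewrite !transpK /h /D /f; ring.
have nab : a != b by lia.
have sa : a \in iota 0 n by rewrite mem_iota.
have sb : b \in iota 0 n by rewrite mem_iota.
have D0 i j : i != a -> i != b -> j != a -> j != b -> D i j = 0.
  by rewrite /D => *; rewrite /transp !ifN ?subrr.
have Ds i j : D i j = (if i == a then if j == b then -1 else
  - (a < j < b)%N%:R else if i == b then if j == a then 1 else (a < j < b)%N%:R
  else if j == a then (a < i < b)%N%:R else if j == b then - (a < i < b)%N%:R
  else 0).
  rewrite /D; case_transp; lia.
have hs i : i != a -> i != b -> \sum_(j <- iota 0 n) h i j = h i a + h i b.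
  move=> ia ib; rewrite (sum_pair _ (iota_uniq 0 n) sa sb nab) big1 ?addr0 // => j.
  by move=> /andP[ja jb]; rewrite /h D0 ?mulr0.
suff S : \sum_(i <- iota 0 n) \sum_(j <- iota 0 n) h i j =
    1 + 2 * (\sum_(c <- iota 0 n) ((a < c < b) && (w a < w c < w b)))%N%:R.
  by move: Ew; rewrite S !natz; lia.
rewrite (sum_pair (fun i => \sum_(j <- _) h i j) (iota_uniq 0 n) sa sb nab).
rewrite !(sum_pair (h _) (iota_uniq 0 n) sa sb nab).
under [X in _ + X]eq_bigr => i /andP[ia ib] do rewrite hs //.
rewrite natr_sum (sum_pair _ (iota_uniq 0 n) sa sb nab).
have -> : h a a = 0 by rewrite /h /f ltnn mul0r.
have -> : h b b = 0 by rewrite /h /f ltnn mul0r.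
have -> : h a b = 0 by rewrite /h /f ltnNge ltnW //= mul0r.
have -> : h b a = 1.
  by rewrite /h /f wab Ds !eqxx eq_sym (negPf nab) mulr1.
rewrite !ltnn /= !andbF !addr0 !add0r.
rewrite addrCA -big_split -addrA -big_split /=; congr (_ + _).
rewrite mulr_sumr; apply: eq_bigr => c /andP[ca cb].
have [wca wcb] : w c != w a /\ w c != w b.
  by split; [apply: contra ca|apply: contra cb] => /eqP/Sinf_inj ->.
rewrite /h /f !Ds !eqxx (negPf ca) (negPf cb) ![b == a]eq_sym (negPf nab).
by move: wca wcb wab; case: (a < c < b)%N; case: ltngtP; case: ltngtP => //= *;
  rewrite ?mulr0 ?mul0r ?mulr1 ?mul1r //; lia.
Qed.

Lemma ell_cov (w : Sinf) (a b : nat) : (a < b)%N ->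
  ell (swap w a b) = (ell w).+1 <-> cov w a b.
Proof.
move=> ab; have [n0 wn0] := Sinf_bound w; pose n := maxn n0 b.+1.
have wn : fixes_from n w by apply: fixes_from_le wn0; lia.
have bn : (b < n)%N by lia.
have [wab|wba] := ltnP (w a) (w b); last first.
  have uab : (swap w a b a < swap w a b b)%N.
    rewrite swapl swapr ltn_neqAle wba andbT.
    by apply/eqP => /Sinf_inj; lia.
  have := ell_swap (fixes_swap (ltn_trans ab bn) bn wn) bn ab uab.
  rewrite swapK => E; split; first by lia.
  by case/covP => _; lia.
rewrite (ell_swap wn bn ab wab); split => [E|/covP[_ _ h]].
  apply/covP; split => // c acb; apply/negP => wacb.
  have cn : c \in iota 0 n by rewrite mem_iota; lia.
  move: E; rewrite (bigD1_seq c) ?iota_uniq //= acb wacb /=.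
  by lia.
rewrite big1 ?muln0 ?addn0 ?addn1 // => c _.
by case acb: (a < c < b)%N => //=; rewrite (negPf (h _ _)).
Qed.

Lemma kcoverP (k : nat) (u : Sinf) (a b : nat) :
  kcover k u a b <-> [/\ (a < k)%N, (k <= b)%N & cov u a b].
Proof.
rewrite /kcover; split => [[/andP[ak kb] E]|[ak kb uab]].
  by split => //; apply/ell_cov => //; lia.
by split; [rewrite ak|apply/ell_cov => //; lia].
Qed.

Lemma cov_adj (w : Sinf) (i : nat) : cov w i i.+1 = (w i < w i.+1)%N.
Proof. by rewrite /cov ltnSn subnn andbT. Qed.

Lemma ell_descent (w : Sinf) (i : nat) :
  ell w = (ell (swap w i i.+1)).+1 <-> (w i.+1 < w i)%N.
Proof.
have := ell_cov (swap w i i.+1) (ltnSn i).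
by rewrite cov_adj swapK swapl swapr.
Qed.

(** Decreases when an adjacent ascent at positions < n is turned into a descent; it
    is the measure for sorting a permutation into decreasing order. *)
Definition ascent_weight (n : nat) (w : Sinf) : nat := (\sum_(i <- iota 0 n) i * w i)%N.

Lemma ascent_weight_swap (n i : nat) (w : Sinf) :
  (i.+1 < n)%N -> (w i < w i.+1)%N ->
  (ascent_weight n (swap w i i.+1) < ascent_weight n w)%N.
Proof.
move=> i_n wi; rewrite /ascent_weight.
have si : i \in iota 0 n by rewrite mem_iota; lia.
have si1 : i.+1 \in rem i (iota 0 n).
  by rewrite mem_rem_uniq ?iota_uniq // !inE mem_iota; lia.
rewrite !(perm_big _ (perm_to_rem si)) !big_cons.
rewrite !(perm_big _ (perm_to_rem si1)) !big_cons.
rewrite swapl swapr.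
have -> : (\sum_(j <- rem i.+1 (rem i (iota 0 n))) j * swap w i i.+1 j =
           \sum_(j <- rem i.+1 (rem i (iota 0 n))) j * w j)%N.
  rewrite !big_seq; apply: eq_bigr => j.
  rewrite mem_rem_uniq ?rem_uniq ?iota_uniq // inE => /andP[ji1].
  rewrite mem_rem_uniq ?iota_uniq // inE => /andP[ji _].
  by rewrite swapo.
rewrite !mulSn /=; move: (\sum_(_ <- _) _)%N => S.
by move: (i * w i)%N (i * w i.+1)%N; lia.
Qed.

Lemma ascent_or_decreasing (n : nat) (w : Sinf) :
  (exists i, (i.+1 < n)%N /\ (w i < w i.+1)%N) \/
  (forall i j, (i < j)%N -> (j < n)%N -> (w j < w i)%N).
Proof.
have [/hasP[i]|/hasPn noasc] := boolP (has (fun i => w i < w i.+1)%N (iota 0 n.-1)).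
  by rewrite mem_iota => i_n wi; left; exists i; split => //; lia.
right => i j; elim: j => // j IH; rewrite ltnS leq_eqVlt => ij jn.
have wj : (w j.+1 < w j)%N.
  have : j \in iota 0 n.-1 by rewrite mem_iota; lia.
  move/noasc; rewrite -leqNgt leq_eqVlt => /orP[/eqP/Sinf_inj|//]; lia.
case/predU1P: ij => [-> //|ij]; apply: ltn_trans wj _; apply: IH => //; lia.
Qed.

(** A decreasing sequence of n values below n has no room to skip one. *)
Lemma decreasing_longest (n : nat) (w : Sinf) : fixes_from n w ->
  (forall i j, (i < j)%N -> (j < n)%N -> (w j < w i)%N) -> w = longest n.
Proof.
move=> wn dec; apply: Sinf_ext => i; rewrite /= /longest_fun.
case: ltnP => [i_n|/wn //].
have up d : forall i, (i < n)%N -> (i + d < n)%N -> (w (i + d) + d <= w i)%N.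
  elim: d => [|d IH] j jn jdn; first by rewrite !addn0.
  have := IH j jn; have := dec (j + d)%N (j + d.+1)%N; lia.
have := up i 0%N; have := up (n.-1 - i)%N i i_n; rewrite !add0n.
have := fixes_lt wn (i := 0%N); have -> : (i + (n.-1 - i) = n.-1)%N by lia.
lia.
Qed.

Lemma longest_fixes (n : nat) : fixes_from n (longest n).
Proof. by move=> i ni; rewrite /= /longest_fun ltnNge ni. Qed.

Lemma longestE (n i : nat) : (i < n)%N -> longest n i = (n.-1 - i)%N.
Proof. by rewrite /= /longest_fun => ->. Qed.

(** * Grothendieck polynomials are well defined *)
Section DescentGraph.

Variables (V : Type) (pi : nat -> V -> V) (n : nat) (top : V).

Hypothesis pi_far :
  forall i j f, (i.+1 < j)%N -> pi i (pi j f) = pi j (pi i f).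
Hypothesis pi_braid :
  forall i f, pi i (pi i.+1 (pi i f)) = pi i.+1 (pi i (pi i.+1 f)).

(** Paths of descents that all start at the longest element of one fixed S_n; the
    start is allowed to vary in Groth_graph. *)
Inductive descent_graph : Sinf -> V -> Prop :=
| Descent_top : descent_graph (longest n) top
| Descent_step (w : Sinf) (i : nat) (f : V) :
    descent_graph w f -> (w i.+1 < w i)%N ->
    descent_graph (swap w i i.+1) (pi i f).

Lemma descent_lt (w : Sinf) i :
  fixes_from n w -> (w i.+1 < w i)%N -> (i.+1 < n)%N.
Proof.
move=> wn wi; rewrite ltnNge; apply/negP => ni; move: wi; rewrite (wn _ ni).
have [/wn ->|i_n] := leqP n i; first by lia.
by have := fixes_lt wn i_n; lia.
Qed.

Lemma descent_graph_fixes w f : descent_graph w f -> fixes_from n w.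
Proof.
elim=> [|{}w i {}f _ wn wi]; first exact: longest_fixes.
by have := descent_lt wn wi; move=> i_n; apply: fixes_swap wn; lia.
Qed.

Lemma descent_graph_up (u : Sinf) i g : (u i < u i.+1)%N ->
  descent_graph (swap u i i.+1) g -> descent_graph u (pi i g).
Proof.
move=> ui ug; have := Descent_step ug (i := i).
by rewrite swapl swapr swapK; apply.
Qed.

Lemma descent_graph_ex w : fixes_from n w -> exists f, descent_graph w f.
Proof.
move: {2}(ascent_weight n w) (leqnn (ascent_weight n w)) => m.
elim: m w => [|m IH] w wm wn; have [[i [i_n wi]]|dec] := ascent_or_decreasing n w.
- by have := ascent_weight_swap i_n wi; lia.
- by rewrite (decreasing_longest wn dec); exists top; constructor.
- have [||f uf] := IH (swap w i i.+1).
  + by have := ascent_weight_swap i_n wi; lia.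
  + by apply: fixes_swap wn; lia.
  by exists (pi i f); apply: descent_graph_up wi uf.
- by rewrite (decreasing_longest wn dec); exists top; constructor.
Qed.

Lemma descent_graph_inv u f : descent_graph u f ->
  (u = longest n /\ f = top) \/
  exists i g, [/\ (i.+1 < n)%N, (u i < u i.+1)%N,
                  descent_graph (swap u i i.+1) g & f = pi i g].
Proof.
case=> [|w i {}f wf wi]; first by left.
right; exists i, f; rewrite swapl swapr swapK; split => //.
exact: descent_lt (descent_graph_fixes wf) wi.
Qed.

Lemma longest_descent i : (i.+1 < n)%N -> (longest n i.+1 < longest n i)%N.
Proof. by move=> i_n; rewrite !longestE; lia. Qed.

(** The diamond lemma: two last steps at different positions i and j are both
    preceded by the common element whose values at the positions involved are
    decreasing, and the two ways down from it agree by the commutation or the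
    braid relation. *)
Lemma descent_graph_fun u f f' :
  descent_graph u f -> descent_graph u f' -> f = f'.
Proof.
move: {2}(ascent_weight n u) (leqnn (ascent_weight n u)) => m.
elim: m u f f' => [|m IH] u f f' um uf uf'.
all: have un := descent_graph_fixes uf.
all: case: (descent_graph_inv uf) => [[uE ->]|[i [g [i_n ui wg fE]]]].
all: case: (descent_graph_inv uf') => [[uE' ->]|[j [g' [jn uj wg' fE']]]] //.
all: try by [move: uj; rewrite uE; have := longest_descent jn; lia
            |move: ui; rewrite uE'; have := longest_descent i_n; lia].
  by have := ascent_weight_swap i_n ui; lia.
have IHi w h h' : (ascent_weight n w < ascent_weight n u)%N ->
  descent_graph w h -> descent_graph w h' -> h = h'.
  by move=> wu; apply: IH; lia.
rewrite fE fE'; clear f f' uf uf' fE fE' IH.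
wlog ij : i j g g' i_n ui wg jn uj wg' / (i <= j)%N.
  move=> H; case: (leqP i j) => [|/ltnW]; first exact: H.
  by move=> ji; apply/esym; apply: H.
(* Positions at distance at least two: the two steps commute. *)
have [ij1|] := ltnP i.+1 j.
  have [|h vh] := @descent_graph_ex (swap (swap u i i.+1) j j.+1).
    by do 2! (apply: fixes_swap; [lia|lia|]).
  have gE : g = pi j h.
    apply: IHi wg _; first exact: ascent_weight_swap.
    by apply: descent_graph_up vh; rewrite !swapo; lia.
  have gE' : g' = pi i h.
    apply: IHi wg' _; first exact: ascent_weight_swap.
    apply: descent_graph_up; first by rewrite !swapo; lia.
    suff -> : swap (swap u j j.+1) i i.+1 = swap (swap u i i.+1) j j.+1 by [].
    by apply: Sinf_ext => k /=; rewrite (transp_far _ ij1).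
  by rewrite gE gE' pi_far.
rewrite leq_eqVlt => /orP[/eqP ji|ji]; last first.
  have {}ji : j = i by lia.
  rewrite ji in wg' *; congr (pi _ _).
  by apply: IHi wg wg'; apply: ascent_weight_swap.
(* Neighbouring positions: both paths start where three values are decreasing. *)
subst j; have [|h vh] :=
    @descent_graph_ex (swap (swap (swap u i i.+1) i.+1 i.+2) i i.+1).
  by do 3! (apply: fixes_swap; [lia|lia|]).
have [v1 v2 v3] : [/\ swap u i i.+1 i = u i.+1, swap u i i.+1 i.+1 = u i
  & swap u i i.+1 i.+2 = u i.+2].
  by split; [exact: swapl|exact: swapr|apply: swapo; lia].
have [v1' v2' v3'] : [/\ swap u i.+1 i.+2 i = u i,
    swap u i.+1 i.+2 i.+1 = u i.+2 & swap u i.+1 i.+2 i.+2 = u i.+1].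
  by split; [apply: swapo; lia|exact: swapl|exact: swapr].
have gE : g = pi i.+1 (pi i h).
  apply: IHi wg _; first exact: ascent_weight_swap.
  apply: descent_graph_up; first by rewrite v2 v3; lia.
  apply: descent_graph_up vh; rewrite swapl v3 swapo ?v1; lia.
have gE' : g' = pi i (pi i.+1 h).
  apply: IHi wg' _; first exact: ascent_weight_swap.
  apply: descent_graph_up; first by rewrite v1' v2'; lia.
  apply: descent_graph_up; first by rewrite swapr v1' swapo ?v3'; lia.
  suff -> : swap (swap (swap u i.+1 i.+2) i i.+1) i.+1 i.+2 =
    swap (swap (swap u i i.+1) i.+1 i.+2) i i.+1 by [].
  by apply: Sinf_ext => k /=; rewrite transp_braid.
by rewrite gE gE' pi_braid.
Qed.

End DescentGraph.

(* Splits on every boolean test of the goal, innermost first. *)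
Ltac case_if :=
  repeat match goal with
  | |- context [if ?c then _ else _] =>
    lazymatch c with context [if _ then _ else _] => fail | _ =>
      case: (boolP c) => ?
    end
  end.

Section DominantPath.

Variables (R : comNzRingType) (x : nat -> R) (s pi : nat -> R -> R).

Hypothesis sM : forall i, {morph s i : f g / f * g}.
Hypothesis s1 : forall i, s i 1 = 1.
Hypothesis sx : forall i j, s i (x j) = x (transp i i.+1 j).
Hypothesis pi_x : forall i c m, s i c = c ->
  pi i (x i ^+ m.+1 * x i.+1 ^+ m * c) = x i ^+ m * x i.+1 ^+ m * c.

Definition monomial (n : nat) (e : nat -> nat) : R :=
  \prod_(i <- iota 0 n) x i ^+ e i.

Lemma monomialS n e : monomial n.+1 e = monomial n e * x n ^+ e n.
Proof. by rewrite /monomial -addn1 iotaD big_cat big_seq1. Qed.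

Lemma eq_monomial n e e' :
  (forall i, (i < n)%N -> e i = e' i) -> monomial n e = monomial n e'.
Proof.
move=> ee; rewrite /monomial !big_seq; apply: eq_bigr => i.
by rewrite mem_iota => /ee ->.
Qed.

(** At x_j^(m+1) x_(j+1)^m times a factor free of both variables, the operator
    just lowers the exponent of x_j by one. *)
Lemma pi_monomial n e e' j : (j.+1 < n)%N -> e j = (e j.+1).+1 ->
  e' j = e j.+1 -> (forall i, i != j -> e' i = e i) ->
  pi j (monomial n e) = monomial n e'.
Proof.
move=> jn ej ej' eo; rewrite /monomial.
have sj : j \in iota 0 n by rewrite mem_iota; lia.
have sj1 : j.+1 \in [seq i <- iota 0 n | i != j].
  by rewrite mem_filter mem_iota; lia.
have split_pair f : \prod_(i <- iota 0 n) x i ^+ f i = x j ^+ f j * x j.+1 ^+ f j.+1 *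
    \prod_(i <- iota 0 n | (i != j) && (i != j.+1)) x i ^+ f i.
  rewrite (bigD1_seq j) ?iota_uniq //= -mulrA; congr (_ * _).
  rewrite -big_filter (bigD1_seq j.+1) ?filter_uniq ?iota_uniq //=.
  by rewrite big_filter_cond.
rewrite !split_pair ej ej' (eo j.+1); last by lia.
rewrite pi_x; first by congr (_ * _); apply: eq_bigr => i /andP[ij _]; rewrite eo.
apply: (big_ind (fun c => s j c = c)) => [|f g fj gj|i /andP[ij ij1]].
- exact: s1.
- by rewrite sM fj gj.
elim: (e i) => [|k IH]; first by rewrite expr0 s1.
by rewrite exprS sM IH sx /transp (negPf ij) (negPf ij1).
Qed.

(** The values, and the exponents of the monomial, after the largest value of
    longest n.+1 has been moved to position k and the value that follows it from
    position k.+1 to position j.  Along this path all polynomials are monomials. *)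
Definition path_value (n k j i : nat) : nat :=
  (if n < i then i else
   if j <= k then
     if i < j then n.-1 - i else if i == j then n else n - i
   else if i == k then n else if i < j then n.-1 - i
   else if i == j then n.-1 - k else n - i)%N.

Definition path_exponent (n k j i : nat) : nat :=
  (if (i < j) && (i != k) then n.-1 - i else n - i)%N.

Local Notation graph n := (descent_graph pi n (monomial n (fun i => n.-1 - i)%N)).

Lemma path_graph n k j : (k <= n)%N -> (j <= n)%N ->
  exists2 w : Sinf, forall i, w i = path_value n k j i
    & graph n.+1 w (monomial n.+1 (path_exponent n k j)).
Proof.
move=> kn; elim: j => [|j IH] jn.
  exists (longest n.+1) => [i|].
    by rewrite /path_value /= /longest_fun; case_if; lia.
  exact: Descent_top.
have [|w wE wg] := IH; first by lia.
have [jk|jk] := eqVneq j k.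
  exists w => [i|]; first by rewrite wE /path_value; case_if; lia.
  rewrite (@eq_monomial _ (path_exponent n k j.+1) (path_exponent n k j)) // => i _.
  by rewrite /path_exponent; case_if; lia.
exists (swap w j j.+1) => [i|].
  by rewrite /= wE /path_value /transp; case_if; lia.
rewrite -(@pi_monomial n.+1 (path_exponent n k j) (path_exponent n k j.+1) j).
- by apply: Descent_step wg _; rewrite !wE /path_value; case_if; lia.
- by lia.
- by rewrite /path_exponent; case_if; lia.
- by rewrite /path_exponent; case_if; lia.
- by move=> i ij; rewrite /path_exponent; case_if; lia.
Qed.

(** The path for k = n leads from the longest element of S_(n+1) to that of S_n, so
    paths from different longest elements can be compared. *)
Lemma graph_longest_succ n :
  graph n.+1 (longest n) (monomial n (fun i => n.-1 - i)%N).
Proof.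
have [w wE] := path_graph (leqnn n) (leqnn n).
have -> : w = longest n.
  apply: Sinf_ext => i; rewrite wE /path_value /= /longest_fun; case_if; lia.
rewrite (monomialS n (path_exponent n n n)); have -> : path_exponent n n n n = 0%N.
  by rewrite /path_exponent; case_if; lia.
rewrite expr0 mulr1.
rewrite (@eq_monomial n (path_exponent n n n) (fun i => n.-1 - i)%N) // => i i_n.
by rewrite /path_exponent; case_if; lia.
Qed.

(** For k < n the same kind of path ends at a permutation that covers longest n, and
    its monomial has one more factor x_k. *)
Lemma graph_longest_swap n k : (k < n)%N ->
  graph n.+1 (swap (longest n) k n) (x k * monomial n (fun i => n.-1 - i)%N).
Proof.
move=> kn; have [w wE] := path_graph (ltnW kn) (leqnn n).
have -> : w = swap (longest n) k n.
  apply: Sinf_ext => i; rewrite wE /path_value /= /longest_fun /transp; case_if; lia.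
rewrite (monomialS n (path_exponent n k n)); have -> : path_exponent n k n n = 0%N.
  by rewrite /path_exponent; case_if; lia.
rewrite expr0 mulr1.
have -> : monomial n (path_exponent n k n) = x k * monomial n (fun i => n.-1 - i)%N; last by [].
rewrite /monomial; have sk : k \in iota 0 n by rewrite mem_iota.
rewrite !(bigD1_seq k) ?iota_uniq //= mulrA -exprS.
have -> : path_exponent n k n k = (n.-1 - k).+1 by rewrite /path_exponent; case_if; lia.
suff -> : \prod_(i <- iota 0 n | i != k) x i ^+ path_exponent n k n i =
          \prod_(i <- iota 0 n | i != k) x i ^+ (n.-1 - i) by [].
rewrite big_seq_cond [RHS]big_seq_cond; apply: eq_bigr => i /andP[].
by rewrite mem_iota => i_n ik; congr (_ ^+ _); rewrite /path_exponent; case_if; lia.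
Qed.

End DominantPath.

Lemma descent_graph_trans (V : Type) (pi : nat -> V -> V) m n t t' w f :
  descent_graph pi m t (longest n) t' -> descent_graph pi n t' w f ->
  descent_graph pi m t w f.
Proof.
by move=> nm; elim=> [//|{}w i {}f _ wf wi]; apply: Descent_step wf wi.
Qed.

Lemma monomial_ord (R : comNzRingType) (x : nat -> R) n (e : nat -> nat) :
  \prod_(i < n) x i ^+ e i = monomial x n e.
Proof.
by rewrite -(big_mkord xpredT (fun i => x i ^+ e i)) /index_iota subn0.
Qed.

Definition staircase (n : nat) : Zpoly := monomial x_ n (fun i => n.-1 - i)%N.

Local Notation isob_graph n := (descent_graph isob n (staircase n)).

(** Paths from longest m are extended upwards by the path from longest n to it. *)
Lemma isob_graph_le m n w f :
  (m <= n)%N -> isob_graph m w f -> isob_graph n w f.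
Proof.
move=> /subnK <-; elim: (n - m)%N => [//|d IH] /IH wf.
rewrite addSn; apply: descent_graph_trans wf.
exact: graph_longest_succ s_M s_1 s_x isob_x _.
Qed.

Lemma isob_graph_fun m n w f f' :
  isob_graph m w f -> isob_graph n w f' -> f = f'.
Proof.
move=> /(isob_graph_le (leq_maxl m n)) wf /(isob_graph_le (leq_maxr m n)) wf'.
exact: (@descent_graph_fun _ isob _ _ (@isob_far) isob_braid _ _ _ wf wf').
Qed.

Lemma Groth_graph_isob w f : Groth_graph w f -> exists n, isob_graph n w f.
Proof.
elim=> [n|{}w i {}f _ [n wf] /ell_descent wi].
  by exists n; rewrite (monomial_ord x_ n (fun i => n.-1 - i)%N); apply: Descent_top.
by exists n; apply: Descent_step.
Qed.

Lemma isob_graph_Groth n w f : isob_graph n w f -> Groth_graph w f.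
Proof.
elim=> [|{}w i {}f _ wf wi].
  by rewrite /staircase -(monomial_ord x_ n (fun i => n.-1 - i)%N); apply: Groth_longest.
by apply: Groth_descent wf _; apply/ell_descent.
Qed.

Lemma Groth_eq n w f : isob_graph n w f -> Groth w = f.
Proof.
move=> wf; rewrite /Groth.
case: xgetP => [g _ /Groth_graph_isob[m wg]|/(_ f)]; first exact: isob_graph_fun wg wf.
by case; apply: isob_graph_Groth wf.
Qed.

Lemma Groth_isob_graph n w : fixes_from n w -> isob_graph n w (Groth w).
Proof. by move=> /(descent_graph_ex isob (staircase n))[f wf]; rewrite (Groth_eq wf). Qed.

(** w -> w s_i at a descent and w -> w at an ascent: multiplication by s_i in the
    0-Hecke monoid, which is how the operators act on Grothendieck polynomials. *)
Definition sortT (i : nat) (w : Sinf) : Sinf :=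
  if (w i.+1 < w i)%N then swap w i i.+1 else w.

(** At an ascent G_w lies in the image of the idempotent pi_i. *)
Lemma isob_Groth i w : isob i (Groth w) = Groth (sortT i w).
Proof.
have [n wn] := Sinf_bound w; rewrite /sortT; case: ltnP => [wi|].
  by rewrite (Groth_eq (Descent_step (Groth_isob_graph wn) wi)).
rewrite leq_eqVlt => /orP[/eqP/Sinf_inj|wi]; first lia.
have ws : fixes_from (maxn n i.+2) (swap w i i.+1).
  by apply: fixes_swap; [lia|lia|apply: fixes_from_le wn; lia].
have := Groth_eq (descent_graph_up wi (Groth_isob_graph ws)) => E.
by apply: etrans (congr1 (isob i) E) (etrans _ (esym E)); apply: isobK.
Qed.

Lemma Groth_longestE n : Groth (longest n) = staircase n.
Proof. exact: Groth_eq (Descent_top _ _ _). Qed.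

Lemma x_Groth_longest n k : (k < n)%N ->
  x_ k * Groth (longest n) = Groth (swap (longest n) k n).
Proof.
move=> kn; rewrite Groth_longestE; apply/esym.
exact: Groth_eq (graph_longest_swap s_M s_1 s_x isob_x kn).
Qed.

Lemma Groth1 : Groth (longest 0) = 1.
Proof. by rewrite Groth_longestE /staircase /monomial big_nil. Qed.

(** * Marked chains and signed sums over them *)
#[local] Arguments Sinf_fun : simpl never.

Lemma swapE (w : Sinf) a b i : swap w a b i = w (transp a b i).
Proof. by []. Qed.

(** S records the rows that a chain has used so far; by (P2) these rows can no
    longer be marked. *)
Definition mark_used (S : nat -> bool) (a : nat) : nat -> bool := fun c => (c == a) || S c.

Lemma mark_usedC S a c : mark_used (mark_used S a) c = mark_used (mark_used S c) a.
Proof. by apply: funext => d; rewrite /mark_used orbCA. Qed.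

(** The state of a chain consists of the permutation w reached, the used rows S,
    and the next admissible label (a, b): it goes through the rows a < k of column b
    upwards, then on to column b - 1, down to column c0.  A marked cover resets
    the row to 0, an unmarked one moves it beyond its own row, as (P3) demands. *)
Section ChainSums.

Variables (k c0 : nat).
Hypothesis kc0 : (k <= c0)%N.

Definition column_sum (w : Sinf) (b : nat) : nat := (\sum_(c0 <= c < b.+1) w c)%N.

(** Covers in column b lower the value there and leave the columns before b alone;
    so the sum of the values of the columns c0, ..., b decreases with every cover,
    although marks reset the row. *)
Definition chain_fuel (w : Sinf) (a b : nat) : nat :=
  ((column_sum w b + (b - c0)) * k.+1 + (k - a)).+1%N.

Lemma column_sum_swap (w : Sinf) a b : (a < k)%N -> (c0 <= b)%N -> cov w a b ->
  (column_sum (swap w a b) b < column_sum w b)%N.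
Proof.
move=> ak cb /covP[ab wab _]; rewrite /column_sum !big_nat_recr //= swapr.
rewrite (eq_big_nat _ _ (F2 := w)); first by rewrite ltn_add2l.
by move=> c /andP[c0c cb']; rewrite swapo //; lia.
Qed.

Lemma fuel_row w a b : (a < k)%N -> (chain_fuel w a.+1 b < chain_fuel w a b)%N.
Proof. by rewrite /chain_fuel; lia. Qed.

Lemma fuel_step w a b a' : (a < k)%N -> (c0 <= b)%N -> cov w a b ->
  (chain_fuel (swap w a b) a' b < chain_fuel w a b)%N.
Proof.
move=> ak cb wab; have := column_sum_swap ak cb wab; rewrite /chain_fuel.
by move: (column_sum _ _) (column_sum _ _) => p q pq; nia.
Qed.

Lemma fuel_col w b a' : (c0 < b)%N ->
  (chain_fuel w a' b.-1 < chain_fuel w k b)%N.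
Proof.
move=> cb; have : (column_sum w b.-1 <= column_sum w b)%N.
  by rewrite /column_sum prednK ?big_nat_recr ?leq_addr //; lia.
rewrite /chain_fuel.
by move: (column_sum _ _) (column_sum _ _) => p q pq; nia.
Qed.

Lemma chain_ind (P : Sinf -> (nat -> bool) -> nat -> nat -> Prop) :
  (forall w S a b, (a < k)%N -> (c0 <= b)%N -> P w S a.+1 b ->
     (cov w a b -> P (swap w a b) (mark_used S a) 0%N b /\
                   P (swap w a b) (mark_used S a) a.+1 b) -> P w S a b) ->
  (forall w S b, (c0 < b)%N -> P w S 0%N b.-1 -> P w S k b) ->
  (forall w S, P w S k c0) ->
  forall w S a b, (a <= k)%N -> (c0 <= b)%N -> P w S a b.
Proof.
move=> Prow Pcol Pend w S a b.
move: {2}(chain_fuel w a b) (leqnn (chain_fuel w a b)) => n.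
elim: n w S a b => [|n IH] w S a b; first by rewrite leqn0.
move=> wn; rewrite leq_eqVlt => /orP[/eqP ak|ak] cb.
  subst a; have [bc|cltb] := eqVneq b c0; first by rewrite bc.
  have {cltb}cb' : (c0 < b)%N by rewrite ltn_neqAle eq_sym cltb.
  by apply: Pcol => //; apply: IH; have := fuel_col w 0 cb'; lia.
apply: Prow => //; first by apply: IH => //; have := fuel_row w b ak; lia.
move=> wab; have f a' := fuel_step a' ak cb wab.
by split; apply: IH => //; [have := f 0%N; lia|have := f a.+1; lia].
Qed.

Fixpoint chain_list_rec (n : nat) (w : Sinf) (S : nat -> bool) (a b : nat) :
    seq mchain :=
  if n is n'.+1 then
    if (a < k)%N then
      chain_list_rec n' w S a.+1 b ++
      (if cov w a b then
         (if ~~ S a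
          then map (cons (a, b, true))
                 (chain_list_rec n' (swap w a b) (mark_used S a) 0 b)
          else [::]) ++
         map (cons (a, b, false))
           (chain_list_rec n' (swap w a b) (mark_used S a) a.+1 b)
       else [::])
    else if (c0 < b)%N then chain_list_rec n' w S 0 b.-1
    else [:: [::]]
  else [::].

(** The chains that can continue the given state; chain_list_row, chain_list_col and
    chain_list_end are the recursion without the fuel. *)
Definition chain_list (w : Sinf) (S : nat -> bool) (a b : nat) : seq mchain :=
  chain_list_rec (chain_fuel w a b) w S a b.

Lemma chain_list_rec_stable n w S a b : (a <= k)%N -> (c0 <= b)%N ->
  (chain_fuel w a b <= n)%N -> chain_list_rec n w S a b = chain_list w S a b.
Proof.
move=> ak cb; rewrite /chain_list; move: {2 4}(chain_fuel w a b) (leqnn (chain_fuel w a b)).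
move=> m; elim: n m w S a b ak cb => [|n IH] [|m] w S a b ak cb //=.
move=> wm wn; case: ltnP => [ak'|ka].
  have f1 := fuel_row w b ak'.
  rewrite (IH m) //; try lia; congr (_ ++ _).
  case wab: (cov w a b) => //; have f a' := fuel_step a' ak' cb wab.
  have fa := f a.+1; have f0 := f 0%N.
  by rewrite (IH m (swap w a b) _ a.+1) ?(IH m (swap w a b) _ 0%N) //; lia.
case: ltnP => // cb'; have := fuel_col w 0 cb'; rewrite (_ : k = a); last by lia.
by move=> f; rewrite (IH m) //; lia.
Qed.

Lemma chain_list_row w S a b : (a < k)%N -> (c0 <= b)%N ->
  chain_list w S a b = chain_list w S a.+1 b ++
    (if cov w a b then
       (if ~~ S a then map (cons (a, b, true))
                         (chain_list (swap w a b) (mark_used S a) 0 b)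
        else [::]) ++
       map (cons (a, b, false)) (chain_list (swap w a b) (mark_used S a) a.+1 b)
     else [::]).
Proof.
move=> ak cb; rewrite {1}/chain_list /= ak.
have f1 := fuel_row w b ak.
rewrite chain_list_rec_stable //; congr (_ ++ _).
case wab: (cov w a b) => //; have f a' := fuel_step a' ak cb wab.
by rewrite !chain_list_rec_stable //; apply: f.
Qed.

Lemma chain_list_col w S b : (c0 < b)%N ->
  chain_list w S k b = chain_list w S 0 b.-1.
Proof.
move=> cb; rewrite {1}/chain_list /= ltnn cb chain_list_rec_stable //; first lia.
exact: fuel_col.
Qed.

Lemma chain_list_end w S : chain_list w S k c0 = [:: [::]].
Proof. by rewrite /chain_list /= !ltnn. Qed.

Section Sums.

Variables (R : comNzRingType) (F : Sinf -> R).

Definition chain_term (w : Sinf) (p : nat) (g : mchain) : R :=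
  (-1) ^+ (size g + p) * F (chain_end w g).

Definition chain_sum (w : Sinf) (S : nat -> bool) (a b p : nat) : R :=
  \sum_(g <- chain_list w S a b | nmarks g == p) chain_term w p g.

(** Split by the first cover: not (a, b), or (a, b) marked, or (a, b) unmarked.  A
    mark changes both the length and the number of marks, hence no sign. *)
Lemma chain_sum_row w S a b p : (a < k)%N -> (c0 <= b)%N ->
  chain_sum w S a b p = chain_sum w S a.+1 b p +
    (if cov w a b then
       (if ~~ S a && (0 < p)%N
        then chain_sum (swap w a b) (mark_used S a) 0 b p.-1 else 0)
       - chain_sum (swap w a b) (mark_used S a) a.+1 b p
     else 0).
Proof.
move=> ak cb; rewrite /chain_sum chain_list_row // big_cat; congr (_ + _).
case: (cov w a b); last by rewrite big_nil.
rewrite big_cat big_map; congr (_ + _).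
  case: (S a) => /=; first by rewrite big_nil.
  rewrite big_map; case: p => [|p] /=; first by rewrite big_pred0.
  by apply: eq_bigr => g _; rewrite /chain_term /= addSn addnS !exprS !mulN1r opprK.
rewrite -sumrN; apply: eq_bigr => g _.
by rewrite /chain_term /= addSn exprS mulN1r mulNr.
Qed.

Lemma chain_sum_col w S b p : (c0 < b)%N ->
  chain_sum w S k b p = chain_sum w S 0 b.-1 p.
Proof. by move=> cb; rewrite /chain_sum chain_list_col. Qed.

Lemma chain_sum_end w S p :
  chain_sum w S k c0 p = if p == 0%N then F w else 0.
Proof.
rewrite /chain_sum chain_list_end big_mkcond big_seq1 eq_sym.
by case: eqP => [->|//]; rewrite /chain_term /= mul1r.
Qed.

End Sums.

End ChainSums.

(** * Inverting the passage through a column *)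
Lemma cov_swap (w : Sinf) a b : cov w a b -> cov (swap w a b) a b = false.
Proof.
by move=> /covP[_ wab _]; apply/negP => /covP[_]; rewrite swapl swapr; lia.
Qed.

Section BlockOperator.

Variables (k : nat) (R : comNzRingType).

Implicit Types (X Y : Sinf -> (nat -> bool) -> nat -> R) (C : Sinf -> (nat -> bool) -> Prop).

Definition cover_step a b X w (S : nat -> bool) (p : nat) : R :=
  if cov w a b then X (swap w a b) (mark_used S a) p else 0.

Definition marked_step a b X w (S : nat -> bool) (p : nat) : R :=
  if [&& cov w a b, ~~ S a & (0 < p)%N]
  then X (swap w a b) (mark_used S a) p.-1 else 0.

(** Applied to the sums that start at row 0 of column b this yields the sums that
    start at row a (uncolumn_chain_sum); for a = k these have left column b. *)
Fixpoint uncolumn b a X w (S : nat -> bool) (p : nat) : R :=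
  if a is a'.+1 then
    uncolumn b a' X w S p + cover_step a' b (uncolumn b a' X) w S p
    - marked_step a' b X w S p
  else X w S p.

(** A second cover with the same label is impossible, so the unmarked term in the
    recursion is itself a sum that starts at row a. *)
Lemma uncolumn_chain_sum c0 F a b : (k <= c0)%N -> (c0 <= b)%N -> (a <= k)%N ->
  forall w S p, uncolumn b a (fun w S p => chain_sum k c0 F w S 0 b p) w S p =
                chain_sum k c0 F w S a b p.
Proof.
move=> kc0 cb; elim: a => [//|a IH] ak w S p /=.
rewrite /cover_step /marked_step !IH ?(ltnW ak) //.
rewrite chain_sum_row //; case wab: (cov w a b) => /=; last first.
  by rewrite !addr0 subr0.
rewrite [chain_sum k c0 F (swap w a b) _ a b p]chain_sum_row // (cov_swap wab).
by rewrite addr0 addrA subrK addrK.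
Qed.

Definition closed_under_steps b C : Prop :=
  forall w S a, (a < k)%N -> cov w a b -> C w S -> C (swap w a b) (mark_used S a).

(** Every cover in column b lowers the value w b.  So X at states with w b < n
    determines uncolumn there, and at w b = n it determines the difference between
    uncolumn and X. *)
Lemma uncolumn_ext b C X Y : closed_under_steps b C ->
  forall a, (a <= k)%N -> forall n,
  (forall w S p, C w S -> (w b < n)%N -> X w S p = Y w S p) ->
  (forall w S p, C w S -> (w b < n)%N -> uncolumn b a X w S p = uncolumn b a Y w S p)
  /\ (forall w S p, C w S -> (w b <= n)%N ->
      uncolumn b a X w S p - X w S p = uncolumn b a Y w S p - Y w S p).
Proof.
move=> Cb; elim=> [|a IH] ak n XY; first by split=> // w S p _ _; rewrite !subrr.
have [IH1 IH2] := IH (ltnW ak) n XY.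
have st w S p : C w S -> (w b <= n)%N ->
  (cover_step a b (uncolumn b a X) w S p = cover_step a b (uncolumn b a Y) w S p)
  /\ (marked_step a b X w S p = marked_step a b Y w S p).
  move=> Cw wn; rewrite /cover_step /marked_step; case wab: (cov w a b) => //=.
  have Cw' := Cb _ _ _ ak wab Cw.
  have wn' : (swap w a b b < n)%N.
    by case/covP: wab => _ wab _; rewrite swapr; lia.
  split; first exact: IH1.
  by case: ifP => // _; apply: XY.
split=> w S p Cw wn /=.
  by have [|-> ->] := st w S p Cw; [exact: ltnW|rewrite IH1].
have [-> ->] := st w S p Cw wn; have := IH2 w S p Cw wn.
by move=> /eqP; rewrite subr_eq => /eqP ->; ring.
Qed.

(** Induction on the value w b. *)
Lemma uncolumn_inj b C X Y : closed_under_steps b C ->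
  (forall w S p, C w S -> uncolumn b k X w S p = uncolumn b k Y w S p) ->
  forall w S p, C w S -> X w S p = Y w S p.
Proof.
move=> Cb XY w S p Cw; move: {2}(w b) (leqnn (w b)) => n.
elim: n w S p Cw => [|n IH] w S p Cw wn.
  have [//|_ /(_ w S p Cw wn)] := uncolumn_ext Cb (leqnn k) (n := 0) (X := X) (Y := Y).
  by rewrite XY // => /addrI/oppr_inj.
have [|_ /(_ w S p Cw wn)] := uncolumn_ext Cb (leqnn k) (n := n.+1) (X := X) (Y := Y).
  by move=> u S' q Cu un; apply: IH => //; lia.
by rewrite XY // => /addrI/oppr_inj.
Qed.

Lemma uncolumn_additive (pi : R -> R) b X :
  {morph pi : f g / f + g} -> {morph pi : f g / f - g} -> forall a w S p,
  uncolumn b a (fun w S p => pi (X w S p)) w S p = pi (uncolumn b a X w S p).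
Proof.
move=> piD piB; have pi0 : pi 0 = 0 by have := piB 0 0; rewrite !subrr.
elim=> [//|a IH] w S p /=; rewrite piB piD /cover_step /marked_step !IH.
by congr (_ + _ - _); case: ifP.
Qed.

End BlockOperator.

(** * Exchanging two adjacent rows *)
Definition sort_used (i : nat) (w : Sinf) (S : nat -> bool) : nat -> bool :=
  if (w i.+1 < w i)%N then fun c => S (transp i i.+1 c) else S.

Lemma cov_swap_far_imp (w : Sinf) i a b :
  a != i -> a != i.+1 -> b != i -> b != i.+1 ->
  cov w a b -> cov (swap w i i.+1) a b.
Proof.
move=> ai ai1 bi bi1 /covP[ab wab h]; apply/covP; rewrite !(@swapo w) //.
split=> // c cab; rewrite swapE; apply: h; case_transp; lia.
Qed.

Lemma cov_swap_far (w : Sinf) i a b :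
  a != i -> a != i.+1 -> b != i -> b != i.+1 ->
  cov (swap w i i.+1) a b = cov w a b.
Proof.
move=> ai ai1 bi bi1; apply/idP/idP; last exact: cov_swap_far_imp.
by rewrite -{2}(swapK w i i.+1); apply: cov_swap_far_imp.
Qed.

Lemma cov_sort_far (w : Sinf) i a b :
  a != i -> a != i.+1 -> b != i -> b != i.+1 -> cov (sortT i w) a b = cov w a b.
Proof. by rewrite /sortT; case: ifP => // _; apply: cov_swap_far. Qed.

Lemma transp_disjoint a b c d i : a != c -> a != d -> b != c -> b != d ->
  transp a b (transp c d i) = transp c d (transp a b i).
Proof. by move=> *; case_transp; lia. Qed.

Lemma swapC (w : Sinf) a b c d : a != c -> a != d -> b != c -> b != d ->
  swap (swap w a b) c d = swap (swap w c d) a b.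
Proof. by move=> *; apply: Sinf_ext => i; rewrite !swapE transp_disjoint. Qed.

Lemma swap_sort_far (w : Sinf) i a b :
  a != i -> a != i.+1 -> b != i -> b != i.+1 ->
  swap (sortT i w) a b = sortT i (swap w a b).
Proof.
move=> ai ai1 bi bi1; rewrite /sortT !(@swapo w a b); try by rewrite eq_sym.
by case: ifP => // _; rewrite swapC // eq_sym.
Qed.

Lemma mark_sort_far (w : Sinf) S i a b :
  a != i -> a != i.+1 -> b != i -> b != i.+1 ->
  sort_used i (swap w a b) (mark_used S a) = mark_used (sort_used i w S) a.
Proof.
move=> ai ai1 bi bi1; rewrite /sort_used !(@swapo w a b); try by rewrite eq_sym.
case: ifP => // _; apply: funext => c; rewrite /mark_used; congr (_ || _).
by case_transp; lia.
Qed.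

Lemma sort_used_far (w : Sinf) S i a :
  a != i -> a != i.+1 -> sort_used i w S a = S a.
Proof.
by move=> ai ai1; rewrite /sort_used; case: ifP => // _; congr S; case_transp; lia.
Qed.

Lemma Sinf_neq (w : Sinf) a b : a != b -> w a != w b.
Proof. by apply: contra => /eqP/Sinf_inj ->. Qed.

Section RowCommutation.

Variables (k c0 i b : nat) (R : comNzRingType).
Hypotheses (ik : (i.+1 < k)%N) (kc0 : (k <= c0)%N) (cb : (c0 <= b)%N).

Implicit Types (X Y : Sinf -> (nat -> bool) -> nat -> R).

Definition sorted_state X w S p := X (sortT i w) (sort_used i w S) p.

(** Covers in rows other than i and i.+1 do not see the exchange of these two. *)
Lemma uncolumn_sort_far a X : (a != i) -> (a != i.+1) ->
  (forall w S p, uncolumn b a (sorted_state X) w S p =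
                 sorted_state (uncolumn b a X) w S p) ->
  forall w S p, uncolumn b a.+1 (sorted_state X) w S p =
                sorted_state (uncolumn b a.+1 X) w S p.
Proof.
move=> ai ai1 H w S p; rewrite /= /cover_step /marked_step H.
have bi : b != i by lia.
have bi1 : b != i.+1 by lia.
rewrite [in RHS]/sorted_state /= /cover_step /marked_step.
rewrite cov_sort_far // sort_used_far // swap_sort_far //.
by rewrite -(mark_sort_far w S ai ai1 bi bi1) H.
Qed.

Lemma uncolumn_sort_below a X : (a <= i)%N ->
  forall w S p, uncolumn b a (sorted_state X) w S p =
                sorted_state (uncolumn b a X) w S p.
Proof.
elim: a => [//|a IH] ai; apply: uncolumn_sort_far; try lia.
by apply: IH; lia.
Qed.

(** The states that the exchange cannot match: w i < w i.+1 with row i.+1 used, and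
    all covers of row i blocked by row i.+1.  Whether row i counts as used must then be
    irrelevant (see chain_sum_lock). *)
Definition locked (w : Sinf) (S : nat -> bool) : Prop :=
  [/\ (w i < w i.+1)%N, S i.+1, (w b < w i)%N,
      forall c, (c0 <= c < b)%N -> ~~ (w i < w c < w i.+1)%N
    & forall e, (i.+1 < e < k)%N -> ~~ (w i < w e < w i.+1)%N].

Definition lock_invariant X : Prop :=
  forall w S p, locked w S -> X w S p = X w (mark_used S i) p.

Lemma locked_step w S a : (a < i)%N -> cov w a b -> locked w S ->
  locked (swap w a b) (mark_used S a).
Proof.
move=> ai /covP[ab wab _] [wi Si wb wc we].
split; rewrite ?swapr ?(@swapo w a b i) ?(@swapo w a b i.+1); try lia.
- by rewrite /mark_used Si orbT.
- by move=> c cb'; rewrite swapo; [apply: wc|lia|lia].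
- by move=> e ek; rewrite swapo; [apply: we|lia|lia].
Qed.

Lemma lock_invariant_uncolumn a X : (a <= i)%N -> lock_invariant X ->
  lock_invariant (uncolumn b a X).
Proof.
move=> + XL; elim: a => [//|a IH] ai w S p wS /=.
have {}IH := IH (ltnW ai); rewrite /cover_step /marked_step (IH w S p wS).
have -> : mark_used S i a = S a by rewrite /mark_used; case: eqP => //; lia.
rewrite (mark_usedC S i a); case wab: (cov w a b) => //=.
have wS' := locked_step ai wab wS.
by rewrite (IH _ _ _ wS'); case: ifP => // _; rewrite (XL _ _ _ wS').
Qed.

Lemma sorted_state_asc X (w : Sinf) S p : (w i < w i.+1)%N ->
  sorted_state X w S p = X w S p.
Proof.
by move=> wi; rewrite /sorted_state /sortT /sort_used ltnNge ltnW.
Qed.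

Lemma ascent_step_left (w : Sinf) : (w i < w i.+1)%N -> cov w i b ->
  (swap w i b i < swap w i b i.+1)%N.
Proof.
move=> wi /covP[ib wib /(_ i.+1) h]; rewrite swapl swapo; [|lia|lia].
have := @Sinf_neq w i.+1 b; lia.
Qed.

Lemma ascent_step_right (w : Sinf) : (w i < w i.+1)%N -> cov w i.+1 b ->
  (swap w i.+1 b i < swap w i.+1 b i.+1)%N.
Proof. by move=> wi /covP[_ wib _]; rewrite swapl swapo; lia. Qed.

(** At an ascent both sides have the same terms, since covers in rows i and i.+1 keep
    the ascent. *)
Lemma uncolumn_sort_rows_asc X (w : Sinf) S p : (w i < w i.+1)%N ->
  uncolumn b i.+2 (sorted_state X) w S p = sorted_state (uncolumn b i.+2 X) w S p.
Proof.
move=> wi; rewrite (sorted_state_asc (uncolumn b i.+2 X) _ _ wi) /=.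
rewrite /cover_step /marked_step !uncolumn_sort_below // !(sorted_state_asc _ _ _ wi).
case wi1b: (cov w i.+1 b); last first.
  rewrite /=; case wib: (cov w i b) => //=.
  by rewrite !(sorted_state_asc _ _ _ (ascent_step_left wi wib)).
have w1 := ascent_step_right wi wi1b.
rewrite !(sorted_state_asc _ _ _ w1).
case w1b: (cov (swap w i.+1 b) i b);
  rewrite ?(sorted_state_asc _ _ _ (ascent_step_left w1 w1b));
  (case wib: (cov w i b) => //=;
   rewrite ?(sorted_state_asc _ _ _ (ascent_step_left wi wib)) //).
Qed.

(** At a descent w i.+1 < w i the covers of w in rows i and i.+1 are compared with
    those of u = w s_i.  The cover of w in row i corresponds to that of u in row i.+1.  A
    cover of w in row i.+1 corresponds to one of u in row i if w b < w i; otherwise u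
    has to use both rows, and its end state is locked. *)
Section Descent.

Variable w : Sinf.
Hypothesis wi : (w i.+1 < w i)%N.

Local Notation u := (swap w i i.+1).

Lemma descent_column : (i.+1 < b)%N. Proof. by lia. Qed.

Lemma descent_u : (u i = w i.+1) * (u i.+1 = w i) * (u b = w b).
Proof. by rewrite swapl swapr swapo //; have := descent_column; lia. Qed.

Lemma descent_u_far c : (i.+1 < c)%N -> u c = w c.
Proof. by move=> ic; rewrite swapo //; lia. Qed.

Lemma descent_cov_twice : cov (swap w i.+1 b) i b = false.
Proof. by apply/negP => /covP[_]; rewrite swapr swapo; have := descent_column; lia. Qed.

Lemma descent_cov_right : cov u i.+1 b = cov w i b.
Proof.
apply/covP/covP => -[_]; rewrite !descent_u => wib h; have bi := descent_column.
  split => // [|c cib]; first lia.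
  have [->|ci] := eqVneq c i.+1; first lia.
  by have := h c; rewrite descent_u_far; lia.
by split => // c cib; have := h c; rewrite descent_u_far; lia.
Qed.

Lemma descent_cov_left : cov u i b = cov w i.+1 b && (w b < w i)%N.
Proof.
have bi := descent_column; apply/covP/andP => [[_]|[/covP[_ wib h] wbi]]; rewrite !descent_u.
  move=> wib h; have := h i.+1; rewrite descent_u; have nib := @Sinf_neq w i b.
  move=> h1; split; last lia.
  by apply/covP; split => // c cib; have := h c; rewrite descent_u_far; lia.
split; [lia|lia|move=> c cib].
have [->|ci] := eqVneq c i.+1; first by rewrite descent_u; lia.
by have := h c; rewrite descent_u_far; lia.
Qed.

Lemma descent_cov_left_after : cov w i b ->
  cov (swap u i.+1 b) i b = cov w i.+1 b.
Proof.
move=> /covP[_ wib hib]; have bi := descent_column.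
have v1 : swap u i.+1 b i = w i.+1 by rewrite swapo ?swapl; lia.
have v2 : swap u i.+1 b i.+1 = w b by rewrite swapl descent_u.
have v3 : swap u i.+1 b b = w i by rewrite swapr swapr.
have v4 c : (i.+1 < c < b)%N -> swap u i.+1 b c = w c.
  by move=> cib; rewrite swapo ?descent_u_far; lia.
apply/covP/covP => -[_]; rewrite v1 v3.
  move=> _ h; split => // [|c cib]; first lia.
  have := @Sinf_neq w c i; have := h c; rewrite v4 //; have := hib c.
  by clear v4 h hib; lia.
move=> wi1b h; split => // [|c cib]; first lia.
have [->|ci] := eqVneq c i.+1; first by rewrite v2; clear v4 h hib; lia.
have ic : (i.+1 < c < b)%N by lia.
by rewrite v4 //; have := h c ic; clear v4 h hib; lia.
Qed.

Lemma descent_cov_both : cov w i.+1 b -> (w i < w b)%N -> cov w i b.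
Proof.
move=> /covP[_ _ h] wib; have bi := descent_column; apply/covP; split => // [|c cib]; first lia.
have [->|ci] := eqVneq c i.+1; first by lia.
by have := h c; lia.
Qed.

Variables (X : Sinf -> (nat -> bool) -> nat -> R) (S : nat -> bool) (r : nat).

Local Notation S' := (fun c => S (transp i i.+1 c)).

Lemma descent_state : sorted_state X w S r = X u S' r.
Proof. by rewrite /sorted_state /sortT /sort_used wi. Qed.

Lemma descent_state_left : cov w i b ->
  sorted_state X (swap w i b) (mark_used S i) r =
  X (swap u i.+1 b) (mark_used S' i.+1) r.
Proof.
move=> /covP[_ wib _]; have bi := descent_column.
rewrite /sorted_state /sortT /sort_used swapl swapo; [|lia|lia].
rewrite (_ : (w i.+1 < w b)%N); last lia.
congr X; first by apply: Sinf_ext => c; rewrite !swapE; congr (w _); case_transp; lia.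
by apply: funext => c; rewrite /mark_used; congr (_ || _); case_transp; lia.
Qed.

Lemma descent_state_right : (w b < w i)%N ->
  sorted_state X (swap w i.+1 b) (mark_used S i.+1) r =
  X (swap u i b) (mark_used S' i) r.
Proof.
move=> wbi; have bi := descent_column.
rewrite /sorted_state /sortT /sort_used swapl swapo; [|lia|lia]; rewrite wbi.
congr X; first by apply: Sinf_ext => c; rewrite !swapE; congr (w _); case_transp; lia.
by apply: funext => c; rewrite /mark_used; congr (_ || _); case_transp; lia.
Qed.

Lemma descent_state_locked : cov w i.+1 b -> (w i < w b)%N -> lock_invariant X ->
  sorted_state X (swap w i.+1 b) (mark_used S i.+1) r =
  X (swap (swap u i.+1 b) i b) (mark_used (mark_used S' i.+1) i) r.
Proof.
move=> /covP[_ wib h] wbi XL; have bi := descent_column.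
rewrite sorted_state_asc; last by rewrite swapl swapo; lia.
rewrite XL.
  congr X; first by apply: Sinf_ext => c; rewrite !swapE; congr (w _); case_transp; lia.
  apply: funext => c; rewrite /mark_used.
  by have [->//|ci] := eqVneq c i; have [->//|ci1] := eqVneq c i.+1;
    congr (_ || (_ || _)); congr S; case_transp; lia.
split; rewrite ?swapl ?swapr ?(@swapo w _ _ i); try lia.
- by rewrite /mark_used eqxx.
- by move=> c cb'; rewrite swapo; [have := h c|..]; lia.
- by move=> e ek; rewrite swapo; [have := h e|..]; lia.
Qed.

End Descent.

(** The extra terms on the side of u, which use both rows, cancel by locking. *)
Lemma uncolumn_sort_rows_desc X (w : Sinf) S q : (w i.+1 < w i)%N ->
  lock_invariant X ->
  uncolumn b i.+2 (sorted_state X) w S q = sorted_state (uncolumn b i.+2 X) w S q.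
Proof.
move=> wi XL; have YL := lock_invariant_uncolumn (leqnn i) XL.
rewrite (descent_state wi) [LHS]/= [RHS]/= /cover_step /marked_step.
rewrite !uncolumn_sort_below //.
set Y := uncolumn b i X in YL *.
rewrite (descent_cov_twice wi) (descent_cov_right wi) (descent_cov_left wi).
rewrite !(descent_state wi _ S).
have S1 : S (transp i i.+1 i.+1) = S i by congr S; case_transp; lia.
have S2 : S (transp i i.+1 i) = S i.+1 by congr S; case_transp; lia.
have S3 : mark_used (fun c => S (transp i i.+1 c)) i.+1 i = S i.+1.
  by rewrite /mark_used S2; case: eqP => //; lia.
rewrite S1 S2 S3 /=.
have [wbi|wib|/Sinf_inj] := ltngtP (w b) (w i); last by have := descent_column; lia.
- have -> : cov w i b = false by apply/negP => /covP[]; lia.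
  by rewrite !(descent_state_right wi) // !andbT; case: (cov w i.+1 b); rewrite /=; ring.
- rewrite andbF /=; case wb: (cov w i b); last first.
    have -> : cov w i.+1 b = false by apply/negP => /descent_cov_both; rewrite wb; auto.
    by rewrite /=; ring.
  rewrite !(descent_state_left wi) // descent_cov_left_after //.
  case wb1: (cov w i.+1 b); last by rewrite /=; ring.
  by rewrite !(descent_state_locked wi) //=; ring.
Qed.

Lemma uncolumn_sort X : lock_invariant X -> forall w S p,
  uncolumn b k (sorted_state X) w S p = sorted_state (uncolumn b k X) w S p.
Proof.
move=> XL; have : forall a, (i.+1 < a <= k)%N -> forall w S p,
    uncolumn b a (sorted_state X) w S p = sorted_state (uncolumn b a X) w S p.
  elim=> [//|a IH] /andP[ia ak] w S p.
  have [ai|ai] := eqVneq a i.+1.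
    rewrite ai; have [wi|wi|/Sinf_inj] := ltngtP (w i) (w i.+1); last by lia.
    - exact: uncolumn_sort_rows_asc.
    - exact: uncolumn_sort_rows_desc.
  by apply: uncolumn_sort_far; [lia|lia|apply: IH; lia].
by apply; rewrite ik leqnn.
Qed.

End RowCommutation.

Section RowExchange.

Variables (k c0 : nat) (R : comNzRingType) (F : Sinf -> R).
Hypothesis kc0 : (k <= c0)%N.

(** Row g > a hides row a: a cover in row a is blocked while the value in the column
    does not lie between w a and w g.  Columns still to come contain no such
    value; in the current column it can only appear by a cover that also moves
    the row limit beyond g, as the rows e > g that could contribute it are used and
    cannot be marked. *)
Definition hidden_row (a : nat) (w : Sinf) (S : nat -> bool) (lo b : nat) : Prop :=
  exists g, [/\ (a < g < k)%N, S g /\ (w a < w g)%N,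
    forall c, (c0 <= c < b)%N -> ~~ (w a < w c < w g)%N,
    forall e, (g < e < k)%N -> (w a < w e < w g)%N -> S e
  & (w a < w b < w g)%N -> (g < lo)%N].

Lemma hidden_row_not_cov a w S b :
  hidden_row a w S a b -> (c0 <= b)%N -> ~~ cov w a b.
Proof.
case=> g [agk [_ wag] _ _ h] cb; apply/negP => /covP[ab wab /(_ g)].
by have := @Sinf_neq w b g; lia.
Qed.

Lemma hidden_row_step a w S e b : hidden_row a w S e b ->
  (e < k)%N -> (c0 <= b)%N -> cov w e b ->
  hidden_row a (swap w e b) (mark_used S e) e.+1 b /\
  (~~ S e -> hidden_row a (swap w e b) (mark_used S e) 0 b).
Proof.
move=> wL ek cb web.
have ea : e != a.
  by apply: contraTneq web => ea; subst e; exact: hidden_row_not_cov wL cb.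
case: wL => g [agk [Sg wag] hc hr hb]; case/covP: web => eb we h.
have va : swap w e b a = w a by rewrite swapo //; lia.
have [eg|eg] := eqVneq e g.
  subst e; rewrite Sg; split => //; exists g; rewrite va swapl swapr.
  split => //; [by rewrite /mark_used eqxx; split; lia| |].
    move=> c cb'; rewrite swapo; [|lia|lia].
    have := hc c cb'; have := h c; have := @Sinf_neq w c g; clear hc hr; lia.
  move=> d dk; rewrite swapo; [|lia|lia] => wd; rewrite /mark_used hr ?orbT //.
  have := h d; have := @Sinf_neq w d g; clear hc hr; lia.
have vg : swap w e b g = w g by rewrite swapo //; lia.
have common lo : ((w a < w e < w g)%N -> (g < lo)%N) ->
    hidden_row a (swap w e b) (mark_used S e) lo b.
  move=> hlo; exists g; rewrite va vg swapr; split => //.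
  - by rewrite /mark_used Sg orbT; split.
  - by move=> c cb'; rewrite swapo; [exact: hc|lia|lia].
  - move=> d dk; rewrite /mark_used; have [//|de] := eqVneq d e.
    by rewrite swapo; [exact: hr|lia|lia].
have wE : (w a < w e < w g)%N -> (g < e)%N.
  by have := h g; have := @Sinf_neq w b g; clear hc hr h; lia.
split; first by apply: common => /wE; lia.
move=> Se; apply: common => wae; case/negP: Se; apply: hr => //.
by have := wE wae; lia.
Qed.

(** A hidden row has no covers, and every cover in another row keeps it hidden; hence
    its flag is never consulted. *)
Lemma chain_sum_hidden_row a w S lo b : (lo <= k)%N -> (c0 <= b)%N ->
  hidden_row a w S lo b -> forall p,
  chain_sum k c0 F w S lo b p = chain_sum k c0 F w (mark_used S a) lo b p.
Proof.
move: w S lo b; apply: (chain_ind kc0) => [w S e b ek cb IH IHc wL p|w S b cb IH wL p|].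
- rewrite [LHS]chain_sum_row // [RHS]chain_sum_row // IH; last first.
    by case: wL => g [gk Sg hc hr hb]; exists g; split => // /hb; lia.
  case web: (cov w e b) => //; have [IH0 IH1] := IHc web.
  have [w1 w0] := hidden_row_step wL ek cb web.
  have ea : e != a.
    by apply: contraTneq web => ea; subst e; exact: hidden_row_not_cov wL cb.
  rewrite IH1 // -mark_usedC; congr (_ + (_ - _)).
  rewrite {2}/mark_used (negPf ea) /=; case Se: (S e) => //=.
  by rewrite IH0 1?mark_usedC //; apply: w0; rewrite Se.
- rewrite !chain_sum_col //; apply: IH; case: wL => g [gk Sg hc hr hb]; exists g.
  split => //; first by move=> c cb'; apply: hc; lia.
  by move=> wab; have := hc b.-1; rewrite wab; lia.
- by move=> w S _ p; rewrite !chain_sum_end.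
Qed.

Lemma chain_sum_lock i b : (i.+1 < k)%N -> (c0 <= b)%N ->
  lock_invariant k c0 i b (fun w S p => chain_sum k c0 F w S 0 b p).
Proof.
move=> ik cb w S p [wi Si wb wc we]; apply: chain_sum_hidden_row => //.
exists i.+1; split => //; [lia| |lia].
by move=> e ek wie; have := we e ek; rewrite wie.
Qed.

Variables (pi : R -> R) (i : nat).
Hypothesis ik : (i.+1 < k)%N.
Hypothesis piD : {morph pi : f g / f + g}.
Hypothesis piB : {morph pi : f g / f - g}.
Hypothesis piF : forall w, F (sortT i w) = pi (F w).

(** By induction on the column, with uncolumn applied to both sides. *)
Lemma chain_sum_sort b w S p : (c0 <= b)%N ->
  chain_sum k c0 F (sortT i w) (sort_used i w S) 0 b p =
  pi (chain_sum k c0 F w S 0 b p).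
Proof.
have pi0 : pi 0 = 0 by have := piB 0 0; rewrite !subrr.
pose Z b w S p := chain_sum k c0 F w S 0 b p.
pose Zk b w S p := chain_sum k c0 F w S k b p.
have step c : (c0 <= c)%N ->
    (forall w S p, sorted_state i (Zk c) w S p = pi (Zk c w S p)) ->
    forall w S p, sorted_state i (Z c) w S p = pi (Z c w S p).
  move=> cc Zkc u A q.
  apply: (@uncolumn_inj k R c (fun _ _ => True) (sorted_state i (Z c))
    (fun w S p => pi (Z c w S p))) => // {}u {}A {}q _.
  rewrite uncolumn_additive // (uncolumn_sort ik kc0 cc); last exact: chain_sum_lock.
  by rewrite /sorted_state !uncolumn_chain_sum //; apply: Zkc.
move=> /subnKC <-; elim: (b - c0)%N w S p => [|d IH] w S p.
  rewrite addn0; apply: step => // {}w {}S {}p.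
  by rewrite /sorted_state /Zk !chain_sum_end; case: ifP.
apply: step => [|{}w {}S {}p]; first lia.
have cd : (c0 < c0 + d.+1)%N by lia.
rewrite /sorted_state /Zk [LHS]chain_sum_col // [chain_sum _ _ _ w _ _ _ _]chain_sum_col //.
by rewrite addnS /= IH.
Qed.

End RowExchange.

(** The fixed point n lies between. *)
Lemma cov_fixed_far n w a b : fixes_from n w -> (a < n)%N -> (n < b)%N ->
  cov w a b = false.
Proof.
move=> wn an nb; apply/negP => /covP[_ _ /(_ n)].
by rewrite (wn n) // (wn b); [have := fixes_lt wn an; lia|lia].
Qed.

Section ChainSumTheory.

Variables (k c0 : nat) (R : comNzRingType).
Hypothesis kc0 : (k <= c0)%N.

Implicit Types (F H : Sinf -> R) (X Y : Sinf -> (nat -> bool) -> nat -> R).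

Lemma chain_sum_flags F w S T lo b : (lo <= k)%N -> (c0 <= b)%N ->
  (forall a, (a < k)%N -> S a = T a) -> forall p,
  chain_sum k c0 F w S lo b p = chain_sum k c0 F w T lo b p.
Proof.
move=> lok cb; move: w S lo b lok cb T; apply: (chain_ind kc0).
- move=> w S e b ek cb IH IHc T ST p.
  rewrite [LHS]chain_sum_row // [RHS]chain_sum_row // (IH T ST) ST //.
  case web: (cov w e b) => //; have [IH0 IH1] := IHc web.
  have ST' a : (a < k)%N -> mark_used S e a = mark_used T e a.
    by move=> ak; rewrite /mark_used ST.
  by rewrite (IH0 _ ST') (IH1 _ ST').
- by move=> w S b cb IH T ST p; rewrite !chain_sum_col //; apply: IH.
- by move=> w S T ST p; rewrite !chain_sum_end.
Qed.

(** The values of F matter only at ends that can be reached. *)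
Lemma eq_chain_sum_on (C : Sinf -> Prop) F H B :
  (forall w a c, (a < k)%N -> (c0 <= c <= B)%N -> cov w a c -> C w ->
     C (swap w a c)) ->
  (forall w, C w -> F w = H w) ->
  forall w S lo b, (lo <= k)%N -> (c0 <= b)%N -> (b <= B)%N -> C w ->
  forall p, chain_sum k c0 F w S lo b p = chain_sum k c0 H w S lo b p.
Proof.
move=> CS FH; apply: (chain_ind kc0).
- move=> w S e b ek cb IH IHc bB Cw p.
  rewrite [LHS]chain_sum_row // [RHS]chain_sum_row // IH //.
  case web: (cov w e b) => //; have [IH0 IH1] := IHc web.
  have Cw' : C (swap w e b) by apply: CS => //; rewrite cb.
  by rewrite IH0 ?IH1.
- by move=> w S b cb IH bB Cw p; rewrite !chain_sum_col //; apply: IH => //; lia.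
- by move=> w S _ Cw p; rewrite !chain_sum_end FH.
Qed.

Lemma chain_sumB F H w S lo b p : (lo <= k)%N -> (c0 <= b)%N ->
  chain_sum k c0 (fun w => F w - H w) w S lo b p =
  chain_sum k c0 F w S lo b p - chain_sum k c0 H w S lo b p.
Proof.
move=> lok cb; move: w S lo b lok cb p; apply: (chain_ind kc0).
- move=> w S e b ek cb IH IHc p.
  rewrite [LHS]chain_sum_row // (chain_sum_row kc0 F) //.
  rewrite (chain_sum_row kc0 H) //.
  case web: (cov w e b); last by rewrite IH !addr0.
  have [IH0 IH1] := IHc web.
  by rewrite IH IH0 IH1; case: ifP => _; ring.
- by move=> w S b cb IH p; rewrite !chain_sum_col.
- by move=> w S p; rewrite !chain_sum_end; case: ifP; rewrite ?subrr.
Qed.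

Lemma chain_sumZ c F w S lo b p : (lo <= k)%N -> (c0 <= b)%N ->
  chain_sum k c0 (fun w => c * F w) w S lo b p = c * chain_sum k c0 F w S lo b p.
Proof.
move=> lok cb; move: w S lo b lok cb p; apply: (chain_ind kc0).
- move=> w S e b ek cb IH IHc p.
  rewrite [LHS]chain_sum_row // (chain_sum_row kc0 F) //.
  case web: (cov w e b); last by rewrite IH !addr0.
  have [IH0 IH1] := IHc web.
  by rewrite IH IH0 IH1; case: ifP => _; ring.
- by move=> w S b cb IH p; rewrite !chain_sum_col.
- by move=> w S p; rewrite !chain_sum_end; case: ifP; rewrite ?mulr0.
Qed.

Lemma chain_sum_no_cover F w S lo b p : (lo <= k)%N -> (c0 <= b)%N ->
  (forall a, (a < k)%N -> cov w a b = false) ->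
  chain_sum k c0 F w S lo b p = chain_sum k c0 F w S k b p.
Proof.
move=> + cb nocov; have [m] := ubnP (k - lo); elim: m lo => // m IH lo km.
rewrite leq_eqVlt => /orP[/eqP-> //|lok].
by rewrite chain_sum_row // nocov // addr0; apply: IH; lia.
Qed.

(** Columns beyond the support of w have no covers. *)
Lemma chain_sum_fixed F n w S b p : (c0 <= n)%N -> (k <= n)%N -> (n <= b)%N ->
  fixes_from n w ->
  chain_sum k c0 F w S 0 b p = chain_sum k c0 F w S 0 n p.
Proof.
move=> cn kn + wn; elim: b => [|b IH]; first by rewrite leqn0 => /eqP->.
rewrite leq_eqVlt => /orP[/eqP-> //|nb].
rewrite chain_sum_no_cover //; try lia; last first.
  by move=> a ak; apply: cov_fixed_far wn _ _; lia.
by rewrite chain_sum_col /= ?IH //; lia.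
Qed.

(** Multiplication by the variable that records the number of marks *)
Definition mark_shift X w S p : R := if p is p'.+1 then X w S p' else 0.

Lemma uncolumn_shift b a X w S p :
  uncolumn b a (mark_shift X) w S p = mark_shift (uncolumn b a X) w S p.
Proof.
elim: a w S p => [//|a IH] w S [|p] /=.
  rewrite !IH /= /cover_step /marked_step IH /= !andbF.
  by case: ifP; rewrite addr0 subr0.
rewrite !IH /= /cover_step /marked_step !IH /= !andbT.
congr (_ + _ - _); case: p => [|p] //=; rewrite ?andbF ?andbT //.
by case: ifP.
Qed.

Lemma uncolumnD b a X Y w S p :
  uncolumn b a (fun w S p => X w S p + Y w S p) w S p =
  uncolumn b a X w S p + uncolumn b a Y w S p.
Proof.
elim: a w S p => [//|a IH] w S p /=; rewrite IH /cover_step /marked_step IH.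
by case: (cov w a b) => /=; last ring; case: ifP => _; ring.
Qed.

End ChainSumTheory.

(** * Chains in a single row *)
Section RowOperator.

Variables (R : comNzRingType) (k : nat).

Implicit Types (F X : Sinf -> R) (w : Sinf).

(** The signed sum of F over the ends of the chains from w in the single row k
    with strictly decreasing columns, all of them at most k + d *)
Fixpoint row_op (d : nat) F w : R :=
  if d is d'.+1 then
    row_op d' F w -
    (if cov w k (k + d) then row_op d' F (swap w k (k + d)) else 0)
  else F w.

Lemma row_opS d F w : row_op d.+1 F w =
  row_op d F w -
  (if cov w k (k + d.+1) then row_op d F (swap w k (k + d.+1)) else 0).
Proof. by []. Qed.

Lemma row_op_no_cover d F w :
  (forall c, (k < c <= k + d)%N -> cov w k c = false) -> row_op d F w = F w.
Proof.
elim: d => [//|d IH] wc /=; rewrite wc; last lia.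
by rewrite subr0; apply: IH => c kc; apply: wc; lia.
Qed.

Section Sorting.

Variables (pi : R -> R) (i : nat).
Hypothesis piB : {morph pi : f g / f - g}.

Lemma pi_zero : pi 0 = 0.
Proof. by have := piB 0 0; rewrite !subrr. Qed.

(** Covers (k, b) do not see the exchange of two positions other than k and b. *)
Lemma row_op_sort_far d F : k != i -> k != i.+1 ->
  (k + d.+1)%N != i -> (k + d.+1)%N != i.+1 ->
  (forall w, row_op d F (sortT i w) = pi (row_op d F w)) ->
  forall w, row_op d.+1 F (sortT i w) = pi (row_op d.+1 F w).
Proof.
move=> ki ki1 di di1 H w /=; rewrite cov_sort_far // swap_sort_far // !H piB.
by case: ifP => // _; rewrite pi_zero.
Qed.

Variable X : Sinf -> R.
Hypothesis XT : forall w, X (sortT i w) = pi (X w).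
Hypothesis ki : (k < i)%N.

Lemma pi_asc w : (w i < w i.+1)%N -> pi (X w) = X w.
Proof. by move=> wi; rewrite -XT /sortT ltnNge ltnW. Qed.

(** The part of the operator in the columns i and i.+1, which have to be treated
    together: a cover in one of them corresponds after the exchange to a cover in
    the other one, or to a chain of two covers. *)
Definition two_columns w : R :=
  X w - (if cov w k i then X (swap w k i) else 0) -
  (if cov w k i.+1 then
     X (swap w k i.+1) -
     (if cov (swap w k i.+1) k i then X (swap (swap w k i.+1) k i) else 0)
   else 0).

Lemma two_columns_asc w : (w i < w i.+1)%N ->
  two_columns w =
  X w - (if cov w k i then X (swap w k i) else 0)
      - (if cov w k i.+1 then X (swap w k i.+1) else 0).
Proof.
move=> wi; rewrite /two_columns; congr (_ - _); case: ifP => // wk.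
have -> : cov (swap w k i.+1) k i = false.
  by apply/negP => /covP[_]; rewrite swapl swapo; lia.
by rewrite subr0.
Qed.

Lemma two_columns_sort_asc w : (w i < w i.+1)%N ->
  two_columns (sortT i w) = pi (two_columns w).
Proof.
move=> wi; rewrite /sortT ltnNge (ltnW wi) /= two_columns_asc // !piB pi_asc //.
congr (_ - _ - _); case: ifP => [/covP[_ wk h]|]; rewrite ?pi_zero ?pi_asc //.
  by rewrite swapr swapo; lia.
rewrite swapr swapo; try lia.
by have := h i; have := @Sinf_neq w i k; lia.
Qed.

Section TwoColumnsDescent.

Variable w : Sinf.
Hypothesis wi : (w i.+1 < w i)%N.

Local Notation u := (swap w i i.+1).

Lemma two_columns_u : (u i = w i.+1) * (u i.+1 = w i) * (u k = w k).
Proof. by rewrite swapl swapr swapo //; lia. Qed.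

Lemma two_columns_u_far c : (c < i)%N -> u c = w c.
Proof. by move=> ci; rewrite swapo //; lia. Qed.

Lemma two_columns_cov_left : cov u k i = cov w k i.+1.
Proof.
apply/covP/covP => -[_]; rewrite !two_columns_u => wk h.
- split => // [|c kc]; first lia.
  have [->|ci] := eqVneq c i; first lia.
  by have := h c; rewrite two_columns_u_far; lia.
- by split => // c kc; rewrite two_columns_u_far; [apply: h; lia|lia].
Qed.

Lemma two_columns_cov_right : cov u k i.+1 = cov w k i && (w i.+1 < w k)%N.
Proof.
apply/covP/andP => [[_]|[/covP[_ wk h] wik]]; rewrite !two_columns_u.
  move=> wk h; have := h i; rewrite two_columns_u; have := @Sinf_neq w i.+1 k.
  move=> h1 h2; split; last by lia.
  apply/covP; split => // c kc.
  by have := h c; rewrite two_columns_u_far; lia.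
split => //; [lia|move=> c kc].
have [->|ci] := eqVneq c i; first by rewrite two_columns_u; lia.
by rewrite two_columns_u_far; [apply: h; lia|lia].
Qed.

Lemma two_columns_cov_after : cov w k i.+1 ->
  cov (swap w k i.+1) k i = cov w k i.
Proof.
move=> /covP[_ wk h]; have v1 : swap w k i.+1 i = w i by rewrite swapo; lia.
have v2 c : (k < c < i)%N -> swap w k i.+1 c = w c by move=> kc; rewrite swapo; lia.
apply/covP/covP => -[_]; rewrite swapl v1 => wi' h'.
- split => // [|c kc]; first lia.
  have := h' c; rewrite v2 //; have := h c; have := @Sinf_neq w c i.+1.
  by clear h h' v2; lia.
- by split => // c kc; have := h' c; rewrite v2 //; clear h h' v2; lia.
Qed.

Lemma two_columns_cov_both : cov w k i -> (w k < w i.+1)%N -> cov w k i.+1.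
Proof.
move=> /covP[_ wk h] wk1; apply/covP; split => // [|c kc]; first lia.
have [->|ci] := eqVneq c i; first by lia.
by have := h c; lia.
Qed.

Lemma two_columns_swaps :
  [/\ swap (swap w k i) i i.+1 = swap u k i.+1,
      swap (swap w k i.+1) i i.+1 = swap u k i
    & swap (swap (swap w k i.+1) k i) i i.+1 = swap w k i].
Proof.
by split; apply: Sinf_ext => c; rewrite !swapE; congr (w _); case_transp; lia.
Qed.

Lemma two_columns_sort_desc : two_columns (sortT i w) = pi (two_columns w).
Proof.
have -> : sortT i w = u by rewrite /sortT wi.
have ui : (u i < u i.+1)%N by rewrite !two_columns_u.
rewrite two_columns_asc // two_columns_cov_left two_columns_cov_right.
have -> : X u = pi (X w) by rewrite -XT /sortT wi.
rewrite /two_columns !piB; have [E1 E2 E3] := two_columns_swaps.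
case wki1: (cov w k i.+1).
  have wk : (w k < w i.+1)%N by case/covP: wki1.
  rewrite two_columns_cov_after // piB.
  have -> : pi (X (swap w k i.+1)) = X (swap u k i).
    by rewrite -E2 -XT /sortT swapr swapo; [rewrite ifT //; lia|lia|lia].
  rewrite [(w i.+1 < w k)%N]ltnNge (ltnW wk) andbF.
  case wki: (cov w k i); last by rewrite pi_zero; ring.
  have -> : pi (X (swap (swap w k i.+1) k i)) = X (swap w k i).
    rewrite -E3 -XT /sortT swapr swapl swapo ?swapr; try lia.
    by rewrite ifT.
  by rewrite (@pi_asc (swap w k i)); [ring|rewrite swapr swapo; lia].
rewrite pi_zero; case wki: (cov w k i); last by rewrite pi_zero /=; ring.
have wik : (w i.+1 < w k)%N.
  rewrite ltnNge leq_eqVlt; apply/negP => /orP[/eqP/Sinf_inj|]; first lia.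
  by move/(two_columns_cov_both wki); rewrite wki1.
rewrite wik -E1 /=.
have -> : pi (X (swap w k i)) = X (swap (swap w k i) i i.+1).
  by rewrite -XT /sortT swapr swapo; [rewrite ifT //; lia|lia|lia].
by ring.
Qed.

End TwoColumnsDescent.

Lemma two_columns_sort w : two_columns (sortT i w) = pi (two_columns w).
Proof.
have [wi|wi|/Sinf_inj] := ltngtP (w i) (w i.+1); last by lia.
- exact: two_columns_sort_asc.
- exact: two_columns_sort_desc.
Qed.

End Sorting.

(** Covers in other columns do not see the exchange of columns i and i.+1, and these
    two are taken together. *)
Lemma row_op_sort (pi : R -> R) i d F : {morph pi : f g / f - g} ->
  (forall w, F (sortT i w) = pi (F w)) ->
  (i.+1 < k)%N \/ (k < i)%N /\ (i.+1 <= k + d)%N ->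
  forall w, row_op d F (sortT i w) = pi (row_op d F w).
Proof.
move=> piB FT [ik|[ki id]].
  elim: d => [//|d IH]; apply: row_op_sort_far => //; lia.
have low d' : (k + d' < i)%N ->
    forall w, row_op d' F (sortT i w) = pi (row_op d' F w).
  elim: d' => [//|d' IH] di; apply: row_op_sort_far => //; try lia.
  by apply: IH; lia.
have := @two_columns_sort pi i piB (row_op (i - k).-1 F) (low _ _) ki.
have di : (k + (i - k).-1.+1 = i)%N by lia.
have di1 : (k + (i - k).-1.+2 = i.+1)%N by lia.
move=> high; have {high}: forall w, row_op (i - k).-1.+2 F (sortT i w) =
  pi (row_op (i - k).-1.+2 F w).
  by move=> w; have := high ltac:(lia) w; rewrite /two_columns /= di di1; apply.
have -> : d = ((i - k).-1.+2 + (d - (i - k).-1.+2))%N by lia.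
elim: (d - _)%N => [|e IH]; first by rewrite addn0.
by rewrite addnS => H; apply: row_op_sort_far => //; try lia; apply: IH.
Qed.

End RowOperator.

(** * The last row acts independently *)
Section LastRow.

Variables (R : comNzRingType) (k : nat).

Implicit Types (F H : Sinf -> R) (w : Sinf) (S : nat -> bool).

#[local] Arguments row_op : simpl never.

(** Both sides hold exactly when the value intervals of the two covers are disjoint
    and nothing else lies between: then the covers can be made in either order. *)
Lemma cov_commute w a c b : (a < k)%N -> (k < c)%N -> (c < b)%N ->
  cov w a c && cov (swap w a c) k b = cov w k b && cov (swap w k b) a c.
Proof.
move=> ak kc cb; set v := swap w a c; set u := swap w k b.
have vc : v c = w a by rewrite /v swapr.
have vo (d : nat) : d != a -> d != c -> v d = w d by move=> *; rewrite /v swapo.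
have uk : u k = w b by rewrite /u swapl.
have uo (d : nat) : d != k -> d != b -> u d = w d by move=> *; rewrite /u swapo.
have vk : v k = w k by apply: vo; lia.
have vb : v b = w b by apply: vo; lia.
have ua : u a = w a by apply: uo; lia.
have uc : u c = w c by apply: uo; lia.
have nak : w a != w k by apply: Sinf_neq; lia.
have ncb : w c != w b by apply: Sinf_neq; lia.
apply/andP/andP => -[/covP[_ w1 h1] /covP[_]].
- rewrite vk vb => w2 h2; have := h2 c; rewrite vc => hc.
  have := h1 k => hk.
  split; apply/covP; rewrite ?ua ?uc; split => //; try lia.
    move=> d kd; have [->|dc] := eqVneq d c; first lia.
    by have := h2 d; rewrite vo; lia.
  move=> d ad; have [->|dk] := eqVneq d k; first lia.
  by rewrite uo; [apply: h1|lia|lia].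
- rewrite ua uc => w2 h2; have := h2 k; rewrite uk => hk.
  have := h1 c => hc.
  split; apply/covP; rewrite ?vk ?vb; split => //; try lia.
    move=> d ad; have [->|dk] := eqVneq d k; first lia.
    by have := h2 d; rewrite uo; lia.
  move=> d kd; have [->|dc] := eqVneq d c; first lia.
  by rewrite vo; [apply: h1|lia|lia].
Qed.

Definition row_cover b F w : R := if cov w k b then F (swap w k b) else 0.

Lemma chain_sum_row_cover b F w S lo c : (lo <= k)%N -> (k < c)%N -> (c < b)%N ->
  forall p, chain_sum k k.+1 (row_cover b F) w S lo c p =
  if cov w k b then chain_sum k k.+1 F (swap w k b) S lo c p else 0.
Proof.
move: w S lo c; apply: (chain_ind (leqnSn k)).
- move=> w S e c ek kc IH IHc cb p.
  rewrite [LHS]chain_sum_row // (IH cb).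
  have cE := cov_commute w ek kc cb.
  have sC : swap (swap w k b) e c = swap (swap w e c) k b by rewrite swapC //; lia.
  case wec: (cov w e c) in cE *; rewrite /= in cE; last first.
    case wkb: (cov w k b) in cE *; rewrite ?addr0 //.
    by rewrite [RHS]chain_sum_row // -[cov (swap w k b) e c]andTb -cE addr0.
  have [IH0 IH1] := IHc wec; rewrite (IH0 cb) (IH1 cb) cE.
  case wkb: (cov w k b) => /=; last by rewrite if_same subrr addr0.
  rewrite [RHS]chain_sum_row // sC; case: (cov (swap w k b) e c) => //.
  by rewrite if_same subrr.
- by move=> w S c kc IH cb p; rewrite chain_sum_col // IH ?chain_sum_col //; lia.
- by move=> w S kb p; rewrite !chain_sum_end /row_cover; case: ifP; case: ifP.
Qed.

Local Notation Z := (chain_sum k k.+1).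

(** The cover of row k in column b can be postponed until the other rows have
    passed through the columns before b. *)
Lemma chain_sum_row_op d F w S p :
  Z (row_op k d.+1 F) w S k (k + d.+1) p =
  Z (row_op k d F) w S k (k + d.+1) p -
  (if cov w k (k + d.+1)
   then Z (row_op k d F) (swap w k (k + d.+1)) S k (k + d.+1) p else 0).
Proof.
have -> : row_op k d.+1 F = fun w => row_op k d F w - row_cover (k + d.+1) (row_op k d F) w by [].
rewrite chain_sumB //; last by lia.
congr (_ - _); case: d => [|d].
  rewrite addn1 !chain_sum_end /row_cover; by case: ifP; case: ifP.
have kd : (k.+1 < k + d.+2)%N by lia.
rewrite chain_sum_col // chain_sum_row_cover //; try lia.
by case: ifP => // _; rewrite [in RHS]chain_sum_col.
Qed.

(** A used last row performs its remaining covers independently of the other rows,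
    as row_op describes.  In an unused one, whose value is still smaller than those
    of the rows before it, either nothing or some chain in row k happens, and the
    first cover of that chain may be marked or not. *)
Definition row_split d F w S p : R :=
  if S k then Z (row_op k d F) w S 0 (k + d) p
  else mark_shift (fun w S p => Z (fun w => F w - row_op k d F w) w S 0 (k + d) p) w S p
       + Z (row_op k d F) w S 0 (k + d) p.

(** The states in which the decomposition holds; they are preserved, since an unused
    row keeps its value while the others only grow. *)
Definition row_ready w S : Prop :=
  S k \/ forall a, (a < k)%N -> (w k < w a)%N.

Lemma row_ready_closed b : (k < b)%N -> closed_under_steps k.+1 b row_ready.
Proof.
move=> kb w S a ak wab; rewrite /row_ready /mark_used.
have [->|ka] := eqVneq k a; first by left.
case=> [Sk|wk]; [by left|right=> c ck]; case/covP: wab => _ wab _.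
rewrite (@swapo w a b k) //; last lia.
have [->|ca] := eqVneq c a; first by rewrite swapl; have := wk a; lia.
by rewrite swapo //; [apply: wk|lia].
Qed.

Lemma uncolumn_split_used d F w S p : S k ->
  uncolumn (k + d.+1) k (row_split d.+1 F) w S p =
  Z (row_op k d.+1 F) w S k (k + d.+1) p.
Proof.
move=> Sk; have kd : (k.+1 <= k + d.+1)%N by lia.
rewrite -uncolumn_chain_sum //.
have CS : closed_under_steps k (k + d.+1) (fun _ S => S k).
  by move=> u T a _ _ Tk; rewrite /mark_used Tk orbT.
have [|+ _] := uncolumn_ext CS (leqnn k) (n := (w (k + d.+1)%N).+1) (X := row_split d.+1 F)
  (Y := fun w S p => Z (row_op k d.+1 F) w S 0 (k + d.+1) p).
  by move=> u T q Tk _; rewrite /row_split Tk.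
by apply.
Qed.

Lemma uncolumn_split_unused d F w S p : ~~ S k ->
  uncolumn (k + d.+1) k (row_split d.+1 F) w S p =
  mark_shift (fun w S p => Z (fun w => F w - row_op k d.+1 F w) w S k (k + d.+1) p) w S p
  + Z (row_op k d.+1 F) w S k (k + d.+1) p.
Proof.
move=> Sk; have kd : (k.+1 <= k + d.+1)%N by lia.
pose A H w S p := Z H w S 0 (k + d.+1) p.
have CS : closed_under_steps k (k + d.+1) (fun _ S => ~~ S k).
  by move=> u T a ak _ Tk; rewrite /mark_used negb_or Tk andbT; lia.
have [|+ _] := uncolumn_ext CS (leqnn k) (n := (w (k + d.+1)%N).+1) (X := row_split d.+1 F)
  (Y := fun w S p => mark_shift (A (fun w => F w - row_op k d.+1 F w)) w S p
                     + A (row_op k d.+1 F) w S p).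
  by move=> u T q Tk _; rewrite /row_split (negPf Tk).
move=> ->//; rewrite uncolumnD uncolumn_shift /A uncolumn_chain_sum //.
by congr (_ + _); case: p => [//|p]; rewrite /mark_shift uncolumn_chain_sum.
Qed.

(** The marked cover (k, b) sends the chain back to row 0 of column b.  Nothing can
    happen in rows before k there, because the column now holds the value
    w k, smaller than all of theirs. *)
Lemma uncolumn_split d F w S p : row_ready w S ->
  uncolumn (k + d.+1) k.+1 (row_split d.+1 F) w S p =
  (if S k then Z (row_op k d F) w S k (k + d.+1) p
   else mark_shift (fun w S p => Z (fun w => F w - row_op k d F w) w S k (k + d.+1) p) w S p
        + Z (row_op k d F) w S k (k + d.+1) p).
Proof.
move=> wS; have kd : (k.+1 <= k + d.+1)%N by lia.
rewrite [LHS]/= /cover_step /marked_step.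
set b := (k + d.+1)%N in kd *; set u := swap w k b.
have UF H lo q : (lo <= k)%N -> Z H u (mark_used S k) lo b q = Z H u S lo b q.
  move=> lok; apply: chain_sum_flags => // a ak.
  by rewrite /mark_used; case: eqP => //; lia.
have ZB H q : Z (fun w => F w - H w) w S k b q = Z F w S k b q - Z H w S k b q.
  exact: chain_sumB.
have ukb : cov w k b -> cov u k b = false by exact: cov_swap.
have Uu q : cov w k b -> uncolumn b k (row_split d.+1 F) u (mark_used S k) q =
    Z (row_op k d F) u S k b q.
  move=> wkb; rewrite uncolumn_split_used; last by rewrite /mark_used eqxx.
  by rewrite UF // chain_sum_row_op -/b ukb // subr0.
case: (boolP (S k)) wS => Sk wS.
  rewrite uncolumn_split_used // andbF subr0 chain_sum_row_op -/b -/u.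
  by case wkb: (cov w k b); rewrite ?Uu // ?subrK // subr0 addr0.
rewrite uncolumn_split_unused // -/b.
have {}wS a : (a < k)%N -> (w k < w a)%N by case: wS => [/(negP Sk)|]; auto.
case wkb: (cov w k b) => /=; last first.
  rewrite addr0 subr0 chain_sum_row_op -/b wkb subr0; congr (_ + _).
  by case: p => [//|p] /=; rewrite !ZB chain_sum_row_op -/b wkb subr0.
rewrite Uu // chain_sum_row_op -/b wkb -/u.
case: p => [|p] /=; first by ring.
have -> : row_split d.+1 F u (mark_used S k) p = Z (row_op k d F) u S k b p.
  rewrite /row_split {1}/mark_used eqxx /=.
  rewrite UF // chain_sum_no_cover //.
    by rewrite chain_sum_row_op -/b ukb // subr0.
  move=> a ak; apply/negP => /covP[_].
  by rewrite /u swapr swapo; [have := wS a ak; lia|lia|lia].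
rewrite !ZB chain_sum_row_op -/b wkb -/u.
by ring.
Qed.

(** Both sides behave in the same way under uncolumn, column by column. *)
Lemma chain_sum_split d F w S p : row_ready w S ->
  chain_sum k.+1 k.+1 F w S 0 (k + d.+1) p = row_split d.+1 F w S p.
Proof.
elim: d w S p => [|d IH] w S p wS.
  have k1 : (k < k + 1)%N by lia.
  apply: (uncolumn_inj (row_ready_closed k1)
    (X := fun w S p => chain_sum k.+1 k.+1 F w S 0 (k + 1) p)
    (Y := row_split 1 F)) wS => {}w {}S {}p wS.
  rewrite [LHS]uncolumn_chain_sum //.
  rewrite [RHS]uncolumn_split // addn1 chain_sum_end.
  case: (S k); rewrite ?chain_sum_end //=.
  case: p => [|p] /=; rewrite ?chain_sum_end /= ?add0r //.
  by case: ifP; rewrite ?subrr addr0.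
have k1 : (k < k + d.+2)%N by lia.
apply: (uncolumn_inj (row_ready_closed k1)
  (X := fun w S p => chain_sum k.+1 k.+1 F w S 0 (k + d.+2) p)
  (Y := row_split d.+2 F)) wS => {}w {}S {}p wS.
rewrite [LHS]uncolumn_chain_sum //.
rewrite [RHS]uncolumn_split // [LHS]chain_sum_col //; last by lia.
have dE : (k + d.+2).-1 = (k + d.+1)%N by lia.
have E H u T q : Z H u T k (k + d.+2) q = Z H u T 0 (k + d.+1) q.
  by rewrite chain_sum_col ?dE //; lia.
rewrite dE IH // /row_split E; case: (S k) => //.
by congr (_ + _); case: p => [//|p]; rewrite /mark_shift E.
Qed.

End LastRow.

(** * The product formula without the condition on the initial run *)
Section DominantTransition.

Variables (R : comNzRingType) (x : nat -> R) (s pi : nat -> R -> R).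
Variable G : Sinf -> R.

(** G stands for the Grothendieck polynomials; what is used about them is the action
    of the operators and the product of a variable with G at a longest element. *)
Local Notation y i := (1 - x i).

Hypothesis sD : forall i, {morph s i : f g / f + g}.
Hypothesis sM : forall i, {morph s i : f g / f * g}.
Hypothesis s1 : forall i, s i 1 = 1.
Hypothesis sx : forall i j, s i (x j) = x (transp i i.+1 j).
Hypothesis piD : forall i, {morph pi i : f g / f + g}.
Hypothesis piB : forall i, {morph pi i : f g / f - g}.
Hypothesis piM : forall i (c f : R), s i c = c -> pi i (c * f) = c * pi i f.
Hypothesis pi_yr :
  forall i (f : R), pi i (y i.+1 * f) = y i.+1 * f + y i * pi i f.
Hypothesis piG : forall i w, pi i (G w) = G (sortT i w).
Hypothesis xG_longest :
  forall k n, (k < n)%N -> x k * G (longest n) = G (swap (longest n) k n).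

Lemma s_y i j : s i (y j) = y (transp i i.+1 j).
Proof.
apply: (addIr (s i (x j))); rewrite -sD subrK s1 sx subrK //.
Qed.

Section Crossing.

Variable k : nat.

Lemma row_op_asc_fixed d (w : Sinf) : (w k < w k.+1)%N ->
  pi k (row_op k.+1 d G w) = row_op k.+1 d G w.
Proof.
elim: d w => [|d IH] w wk /=; first by rewrite piG /sortT ltnNge (ltnW wk).
rewrite piB IH //; congr (_ - _); case: ifP => [/covP[kd wkd _]|_]; last first.
  exact: pi_zero.
by rewrite IH // swapl swapo; lia.
Qed.

(** Chains in row k + 1 of w s_k match chains in row k of w until they jump over the
    value w (k + 1); after that pi_k - 1 kills their contribution. *)
Lemma row_op_crossing d (w : Sinf) : (w k < w k.+1)%N ->
  pi k (row_op k.+1 d G (swap w k k.+1)) - row_op k.+1 d G (swap w k k.+1) =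
  row_op k d.+1 G w.
Proof.
elim: d w => [|d IH] w wk.
  rewrite /= addn1 cov_adj wk piG /sortT swapl swapr wk swapK //.
rewrite (row_opS k d.+1) -IH // (row_opS k.+1 d) addSnnS.
set b := (k + d.+2)%N; set v := swap w k k.+1.
have vk : v k.+1 = w k by rewrite /v swapr.
have vb : v b = w b by rewrite /v swapo; lia.
have vo c : (k.+1 < c)%N -> v c = w c by move=> kc; rewrite /v swapo; lia.
rewrite piB; case vcov: (cov v k.+1 b); last first.
  have -> : cov w k b = false.
    apply/negP => /covP[_ wb h]; case/negP: vcov; apply/covP.
    split; [by rewrite /b; lia|by rewrite vk vb|].
    by move=> c kc; rewrite vk vb vo; [apply: h; lia|lia].
  by rewrite pi_zero // !subr0.
have {vcov}[_ wb h] := covP _ _ _ vcov; rewrite vk vb in wb.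
have kb : (k.+1 < b)%N by rewrite /b; lia.
have [wkb|wkb|/Sinf_inj] := ltngtP (w b) (w k.+1); last by lia.
  have -> : cov w k b.
    apply/covP; split => // [|c kc]; first by lia.
    have [->|ck] := eqVneq c k.+1; first by lia.
    by have := h c; rewrite vk vb vo; lia.
  rewrite -IH; last by rewrite swapl swapo; lia.
  have -> : swap (swap w k b) k k.+1 = swap v k.+1 b.
    by apply: Sinf_ext => c; rewrite !swapE; congr (w _); case_transp; lia.
  by ring.
have -> : cov w k b = false.
  by apply/negP => /covP[_ _ /(_ k.+1)]; lia.
rewrite (@row_op_asc_fixed d (swap v k.+1 b)).
  by ring.
by rewrite swapl vb swapo ?swapl; lia.
Qed.

End Crossing.

(** The only chain of length one leads to longest n with n moved to position k, and no
    chain is longer. *)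
Lemma row_op_longest n k d : (k < n)%N -> (n <= k + d)%N ->
  row_op k d G (longest n) = y k * G (longest n).
Proof.
move=> kn; rewrite mulrBl mul1r xG_longest //.
have nf := @longest_fixes n.
elim: d => [|d IH]; first by lia.
rewrite leq_eqVlt => /orP[/eqP nd|nd] /=; last first.
  by rewrite IH; [rewrite (cov_fixed_far nf) ?subr0 //; lia|lia].
have below c : (k < c < n)%N -> (longest n c < longest n k)%N.
  by move=> kc; rewrite !longestE; lia.
rewrite -nd row_op_no_cover; last first.
  by move=> c kc; apply/negP => /covP[_ ? _]; have := below c; lia.
have -> : cov (longest n) k n.
  apply/covP; split => //; first by rewrite (nf n) // (fixes_lt nf).
  by move=> c kc; have := below c kc; lia.
rewrite row_op_no_cover // => c kc; apply/negP => /covP[_].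
by rewrite swapl (nf n) // swapo; [have := @fixes_lt n c _ nf; lia|lia|lia].
Qed.

(** Transition in a row k whose value is smaller than all values before it: no cover
    then ends at position k, and multiplication by 1 - x_k is the signed sum over the
    chains that start there. *)
Lemma row_op_mul n (w : Sinf) k d : fixes_from n w -> (k < n)%N -> (n <= k + d)%N ->
  (forall a, (a < k)%N -> (w k < w a)%N) -> row_op k d G w = y k * G w.
Proof.
have [m] := ubnP (ascent_weight n w); elim: m w k d => // m IH w k d wm wn kn nd wk.
have [[i [i_n wi]]|dec] := ascent_or_decreasing n w; last first.
  by rewrite (decreasing_longest wn dec); apply: row_op_longest.
pose v := swap w i i.+1.
have vm : (ascent_weight n v < m)%N by have := ascent_weight_swap i_n wi; rewrite -/v; lia.
have vn : fixes_from n v by apply: fixes_swap wn; lia.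
have wT : sortT i v = w by rewrite /sortT /v swapl swapr wi swapK.
have wG : G w = pi i (G v) by rewrite piG wT.
(* An ascent at k: in v the small value w k sits at position k + 1, so the induction
   hypothesis applies to row k + 1. *)
have [ik|ik] := eqVneq i k.
  subst i; case: d nd => [|d] nd; first by lia.
  rewrite -row_op_crossing // -/v.
  rewrite (IH v k.+1 d) //; [rewrite pi_yr wG; ring|by lia|].
  move=> a ak; rewrite swapr; have [->|ak'] := eqVneq a k; first by rewrite swapl.
  by rewrite swapo; [apply: wk; lia|lia|lia].
have ki : k != i.+1 by apply: contraTneq wi => ki; have := wk i; rewrite ki; lia.
have y_i : s i (y k) = y k by rewrite s_y; congr (1 - x _); case_transp; lia.
have far : (i.+1 < k)%N \/ (k < i)%N /\ (i.+1 <= k + d)%N by lia.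
rewrite -{1}wT (row_op_sort (@piB i) (fun w => esym (piG i w)) far).
rewrite (IH v k d) ?piM -?wG // => a ak.
have vk : v k = w k by rewrite /v swapo //; rewrite eq_sym.
have [ia|ia] := eqVneq a i; first by rewrite vk ia /v swapl; have := wk i; lia.
have [ia1|ia1] := eqVneq a i.+1; first by rewrite vk ia1 /v swapr; have := wk i; lia.
by rewrite vk /v swapo //; apply: wk.
Qed.

(** The coefficient of t ^ p in the product of the 1 - x_i + t x_i over i < k *)
Fixpoint marking_poly (k p : nat) : R :=
  if k is k'.+1 then
    y k' * marking_poly k' p +
    x k' * (if p is p'.+1 then marking_poly k' p' else 0)
  else (p == 0%N)%:R.

Lemma s_zero i : s i 0 = 0.
Proof. by apply: (addrI (s i 0)); rewrite -sD !addr0. Qed.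

Lemma s_marking_far i k p : (k <= i)%N -> s i (marking_poly k p) = marking_poly k p.
Proof.
elim: k p => [|k IH] p ki /=; first by case: eqP; rewrite ?s_zero ?s1.
rewrite sD !sM s_y sx (_ : transp i i.+1 k = k); last by case_transp; lia.
by rewrite IH; [case: p => [|p]; rewrite ?s_zero ?IH //; lia|lia].
Qed.

(** The two factors with x_i and x_(i+1) have a symmetric product. *)
Lemma s_marking i k p : (i.+1 < k)%N -> s i (marking_poly k p) = marking_poly k p.
Proof.
elim: k p => [//|k IH] p ik.
have [ik'|ki] := ltnP i.+1 k.
  rewrite /= sD !sM s_y sx (_ : transp i i.+1 k = k); last by case_transp; lia.
  by rewrite IH //; case: p => [|p]; rewrite ?s_zero ?IH.
have -> : k = i.+1 by lia.
have t1 : transp i i.+1 i = i.+1 by case_transp; lia.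
have t2 : transp i i.+1 i.+1 = i by case_transp; lia.
have sE := (sD, sM, s_y, sx, t1, t2, s_zero).
case: p => [|[|p]] /=; rewrite !sE !s_marking_far //; by ring.
Qed.

Definition no_row (c : nat) : bool := false.

Lemma chain_sum_rows0 w S b p :
  chain_sum 0 0 G w S 0 b p = marking_poly 0 p * G w.
Proof.
elim: b => [|b IH]; last by rewrite chain_sum_col.
by rewrite chain_sum_end /=; case: eqP => _; rewrite ?mul1r ?mul0r.
Qed.

Lemma smallest_step (w : Sinf) k a c : (a < k)%N -> (k < c)%N -> cov w a c ->
  (forall e, (e < k)%N -> (w k < w e)%N) ->
  forall e, (e < k)%N -> (swap w a c k < swap w a c e)%N.
Proof.
move=> ak kc /covP[_ wac _] wk e ek; rewrite (@swapo w a c k); [|lia|lia].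
have [->|ea] := eqVneq e a; first by rewrite swapl; have := wk a; lia.
by rewrite swapo //; [apply: wk|lia].
Qed.

(** Position k, holding a value smaller than all rows, is never the column of a
    cover; so starting the columns at k or at k + 1 makes no difference. *)
Lemma chain_sum_extra_column k (w : Sinf) S lo b : (lo <= k)%N -> (k < b)%N ->
  (forall a, (a < k)%N -> (w k < w a)%N) -> forall p,
  chain_sum k k G w S lo b p = chain_sum k k.+1 G w S lo b p.
Proof.
move: w S lo b; apply: (chain_ind (leqnSn k)).
- move=> w S e b ek kb IH IHc wk p.
  rewrite [LHS]chain_sum_row ?(ltnW kb) // [RHS]chain_sum_row // IH //.
  case web: (cov w e b) => //; have [IH0 IH1] := IHc web.
  by have wk' := smallest_step ek kb web wk; rewrite IH0 ?IH1.
- move=> w S b kb IH wk p; rewrite [LHS]chain_sum_col //; last by lia.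
  by rewrite [RHS]chain_sum_col // IH.
- move=> w S wk p; rewrite [LHS]chain_sum_col // chain_sum_no_cover //.
    by rewrite !chain_sum_end.
  by move=> a ak; apply/negP => /covP[_] /=; have := wk a ak; lia.
Qed.

(** By chain_sum_split the last row contributes at each end the factor
    1 - (1 - x_k) = x_k together with one more mark, or 1 - x_k without a mark. *)
Lemma pieri_decreasing n k (v : Sinf) p : fixes_from n v -> (k <= n)%N ->
  (forall a b, (a < b)%N -> (b < k)%N -> (v b < v a)%N) ->
  chain_sum k k G v no_row 0 n.+1 p = marking_poly k p * G v.
Proof.
move=> vn; elim: k p => [|k IH] p kn dec; first exact: chain_sum_rows0.
have vk a : (a < k)%N -> (v k < v a)%N by move=> ak; apply: dec.
have nE : n.+1 = (k + (n - k).+1)%N by lia.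
rewrite {1}nE chain_sum_split; last by right.
set d := (n - k)%N in nE *; rewrite /row_split {1}/no_row -nE.
have kn1 : (k < n.+1)%N by lia.
have last_row H c q : (forall w, fixes_from n.+1 w ->
      (forall a, (a < k)%N -> (w k < w a)%N) -> H w = c * G w) ->
    chain_sum k k.+1 H v no_row 0 n.+1 q = c * (marking_poly k q * G v).
  move=> HG; rewrite -IH; [|lia|by move=> a b ab bk; apply: dec; lia].
  rewrite chain_sum_extra_column // -(chain_sumZ (leqnSn k)) //.
  rewrite !(@chain_sum_fixed k k.+1 R (leqnSn k) _ n) //; try lia.
  (* The ends that occur: row_op_mul applies to them. *)
  pose C (w : Sinf) := fixes_from n.+1 w /\ forall a, (a < k)%N -> (w k < w a)%N.
  apply: (@eq_chain_sum_on k k.+1 R (leqnSn k) C _ _ n) => //.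
  - move=> w a c' ak /andP[kc cn] wac [wn wk]; split; last exact: smallest_step.
    by apply: fixes_swap => //; lia.
  - by move=> w [wn wk]; apply: HG.
  - by split => //; apply: fixes_from_le vn.
have opE w : fixes_from n.+1 w -> (forall a, (a < k)%N -> (w k < w a)%N) ->
    row_op k d.+1 G w = y k * G w.
  by move=> wn wk; apply: row_op_mul wn _ _ wk; lia.
rewrite (last_row _ (y k)) //.
case: p => [|p]; rewrite /mark_shift /=; first by ring.
rewrite (last_row _ (x k)); first by ring.
by move=> w wn wk; rewrite -row_opS opE //; ring.
Qed.

(** Sort the first k values into decreasing order by exchanging adjacent rows; both
    sides follow along. *)
Lemma pieri_markings n k (v : Sinf) p : fixes_from n v -> (k <= n)%N ->
  chain_sum k k G v no_row 0 n.+1 p = marking_poly k p * G v.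
Proof.
move=> + kn; have [m] := ubnP (ascent_weight k v).
elim: m v => // m IH v vm vn.
have [[i [ik vi]]|dec] := ascent_or_decreasing k v; last exact: pieri_decreasing.
pose u := swap v i i.+1.
have um : (ascent_weight k u < m)%N by have := ascent_weight_swap ik vi; rewrite -/u; lia.
have un : fixes_from n u by apply: fixes_swap vn; lia.
have uv : (u i.+1 < u i)%N by rewrite swapl swapr.
have uT : sortT i u = v by rewrite /sortT uv swapK.
have uS : sort_used i u no_row = no_row by rewrite /sort_used uv.
have kn1 : (k <= n.+1)%N by lia.
have FT w : G (sortT i w) = pi i (G w) by rewrite piG.
have := chain_sum_sort (leqnn k) ik (@piD i) (@piB i) FT u no_row p kn1.
by rewrite uT uS => ->; rewrite IH // piM ?piG ?uT // s_marking.
Qed.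

End DominantTransition.

(** * From sums to Pieri chains *)
Lemma isobD i : {morph isob i : f g / f + g}.
Proof. exact: piD s_D xB_reg isobE i. Qed.

Lemma pieri_Groth n k (v : Sinf) p : fixes_from n v -> (k <= n)%N ->
  chain_sum k k Groth v no_row 0 n.+1 p = marking_poly x_ k p * Groth v.
Proof.
have xG k' n' := @x_Groth_longest n' k'.
have piG i w := isob_Groth i w.
exact: (pieri_markings s_D s_M s_1 s_x isobD isobB isobM isob_yr piG xG).
Qed.

Section ChainMembership.

Variable k : nat.

(** Recursive form of the conditions, for chains that continue an arbitrary state *)
Fixpoint chain_ok (w : Sinf) (S : nat -> bool) (lo b : nat) (g : mchain) : bool :=
  if g is (a', b', m) :: g' then
    [&& (a' < k)%N, (k <= b')%N, cov w a' b',
        (b' < b)%N || ((b' == b) && (lo <= a')%N), m ==> ~~ S a'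
      & chain_ok (swap w a' b') (mark_used S a') (if m then 0%N else a'.+1) b' g']
  else true.

Lemma mem_map_cons (c : nat * nat * bool) (g : mchain) (L : seq mchain) :
  (g \in map (cons c) L) = if g is c' :: g' then (c' == c) && (g' \in L) else false.
Proof.
apply/mapP/idP => [[g' g'L ->]|]; first by rewrite eqxx.
by case: g => // c' g' /andP[/eqP-> g'L]; exists g'.
Qed.

Lemma chain_list_ok w S lo b : (lo <= k)%N -> (k <= b)%N ->
  forall g, (g \in chain_list k k w S lo b) = chain_ok w S lo b g.
Proof.
move: w S lo b; apply: (chain_ind (leqnn k)).
- move=> w S e b ek kb IH IHc g; rewrite chain_list_row // mem_cat IH.
  case: g => [//|[[a' b'] m] g] /=.
  have -> : ((b' < b) || (b' == b) && (e <= a'))%N =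
            ((b' < b) || (b' == b) && (e < a'))%N || ((a' == e) && (b' == b)) by lia.
  have [/andP[/eqP ae /eqP be]|ne] := boolP ((a' == e) && (b' == b)); last first.
    rewrite orbF -[RHS]orbF; congr (_ || _); case: (cov w e b) => //.
    rewrite mem_cat !mem_map_cons !xpair_eqE (negPf ne) /= orbF.
    by case: (S e); rewrite //= mem_map_cons !xpair_eqE (negPf ne).
  rewrite ae be ek kb ltnn eqxx ltnn /= andbF /=.
  case web: (cov w e b) => //=; have [IH0 IH1] := IHc web.
  rewrite mem_cat mem_map_cons !xpair_eqE !eqxx /= IH1.
  by case: (S e); case: m; rewrite //= ?mem_map_cons ?xpair_eqE ?eqxx //= IH0 ?orbF.
- move=> w S b kb IH g; rewrite chain_list_col // IH.
  case: g => [//|[[a' b'] m] g] /=; case ak: (a' < k)%N => //=; case kb': (k <= b')%N => //=.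
  by congr [&& _, _ & _]; lia.
- move=> w S g; rewrite chain_list_end.
  case: g => [//|[[a' b'] m] g] /=; rewrite inE; apply/esym/negP => /and5P[ak kb' _ h _].
  by lia.
Qed.

Lemma chain_list_uniq w S lo b : (lo <= k)%N -> (k <= b)%N ->
  uniq (chain_list k k w S lo b).
Proof.
move: w S lo b; apply: (chain_ind (leqnn k)).
- move=> w S e b ek kb IH IHc; rewrite chain_list_row // cat_uniq IH /=.
  case web: (cov w e b) => //; have [IH0 IH1] := IHc web.
  have consI (c : nat * nat * bool) : injective (cons c) by move=> g g' [].
  have uF := map_inj_uniq (@consI (e, b, false)); have uT := map_inj_uniq (@consI (e, b, true)).
  apply/andP; split; last first.
    rewrite cat_uniq uF IH1 andbT; case: (S e) => /=; first by rewrite has_pred0.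
    rewrite uT IH0 /=; apply/hasPn => g; rewrite !mem_map_cons.
    by case: g => // c g /andP[/eqP-> _]; rewrite xpair_eqE andbF.
  apply/hasPn => g; rewrite chain_list_ok //; case: g => [|[[a' b'] m] g] /=.
    by rewrite mem_cat; case: (S e); rewrite /= ?mem_map_cons.
  rewrite mem_cat => gin; have /andP[/eqP-> /eqP->] : (a' == e) && (b' == b).
    move: gin; rewrite !mem_map_cons !xpair_eqE.
    by case: (S e); rewrite /= ?mem_map_cons ?xpair_eqE; case: (a' == e); case: (b' == b).
  by rewrite ltnn eqxx ltnn /= !andbF.
- by move=> w S b kb IH; rewrite chain_list_col.
- by move=> w S; rewrite chain_list_end.
Qed.

End ChainMembership.

Section ChainConditions.

Variable k : nat.

Implicit Types (g : mchain) (w : Sinf) (S : nat -> bool).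

Lemma P1_cons c g : P1 (c :: g) <->
  (if g is c' :: _ then (c'.1.2 <= c.1.2)%N else True) /\ P1 g.
Proof.
split=> [Pg|[Pc Pg] [|i] ig]; first split; last exact: Pg.
- by case: g Pg => // c' g Pg; apply: (Pg 0%N).
- by move=> i ig; apply: (Pg i.+1).
- by case: g Pc Pg ig.
Qed.

Lemma P3_cons c g : P3 (c :: g) <->
  (if g is c' :: _ then ~~ c.2 -> prec c.1 c'.1 else True) /\ P3 g.
Proof.
split=> [Pg|[Pc Pg] [|i] ig]; first split; last exact: Pg.
- by case: g Pg => // c' g Pg; apply: (Pg 0%N).
- by move=> i ig; apply: (Pg i.+1).
- by case: g Pc Pg ig.
Qed.

(** Condition (P2) for a continuation of a chain that has used the rows of S *)
Definition marks_avoid S g : Prop :=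
  P2 g /\ forall i, (i < size g)%N -> marked g i -> ~~ S (lab_a g i).

Lemma marks_avoid_cons S c g : marks_avoid S (c :: g) <->
  (c.2 ==> ~~ S c.1.1) /\ marks_avoid (mark_used S c.1.1) g.
Proof.
split=> [[Pg Sg]|[/implyP Sc [Pg Sg]]].
  split; first by apply/implyP => cm; apply: (Sg 0%N).
  split=> [i ig mi j ji|i ig mi]; first exact: (Pg i.+1 ig mi j.+1).
  rewrite negb_or (Sg i.+1) // andbT; apply/eqP => ic.
  by apply: (Pg i.+1 ig mi 0%N) => //.
split=> [[|i] // ig mi [|j] ji|[|i] ig mi].
- by have := Sg i ig mi; rewrite negb_or eq_sym => /andP[/eqP ic _].
- exact: (Pg i ig mi).
- exact: Sc.
- by have := Sg i ig mi; rewrite negb_or => /andP[].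
Qed.

(** Conditions on consecutive labels become conditions on the first label of the
    rest. *)
Lemma chain_okP w S lo b g : chain_ok k w S lo b g <->
  [/\ is_kchain k w g, P1 g, marks_avoid S g, P3 g &
      if g is c :: _ then (c.1.2 < b)%N || ((c.1.2 == b) && (lo <= c.1.1)%N) else true].
Proof.
elim: g w S lo b => [|[[a' b'] m] g IH] w S lo b.
  by split => // _; split.
split.
  move=> /= /and5P[ak kb cab lob /andP[mS /IH[ch p1 p2 p3 hd]]].
  split => //.
  - by split => //; apply/kcoverP.
  - by apply/P1_cons; split => //; case: g hd {IH ch p1 p2 p3} => // -[[a1 b1] m1] g /=; lia.
  - by apply/marks_avoid_cons; split.
  - apply/P3_cons; split => //; case: g hd {IH ch p1 p2 p3} => // -[[a1 b1] m1] g /=.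
    by rewrite /prec /=; case: m {mS} => //=; lia.
move=> [[/kcoverP[ak kb cab] ch] /P1_cons[h1 p1] /marks_avoid_cons[mS p2] /P3_cons[h3 p3] hd].
apply/and5P; split => //; apply/andP; split => //; apply/IH; split => //.
case: g h1 h3 {IH ch p1 p2 p3} => // -[[a1 b1] m1] g /=.
by rewrite /prec /=; case: m {mS hd} => //= h1 h3; [lia|have := h3 isT; lia].
Qed.

Lemma chain_ok_start n v g : fixes_from n v -> (k <= n)%N ->
  chain_ok k v no_row 0 n.+1 g <-> [/\ is_kchain k v g, P1 g, P2 g & P3 g].
Proof.
move=> vn kn; rewrite chain_okP; split=> [[ch p1 [p2 _] p3 _]|[ch p1 p2 p3]]; first by split.
split => //.
case: g ch {p1 p2 p3} => // -[[a b] m] g [/kcoverP[ak kb cab] _] /=.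
have [nb|bn] := ltnP n b; last lia.
by rewrite (cov_fixed_far vn) // in cab; lia.
Qed.

End ChainConditions.

Section InitialRun.

Implicit Types (g : mchain) (w : Sinf) (S : nat -> bool) (c : nat * nat * bool).

Definition run_continues c g : bool :=
  if g is c' :: _ then (c'.1.2 == c.1.2) && (c'.1.1 < c.1.1)%N else false.

(** Condition (P4) along the list: it asks for a mark at each cover of the initial
    descending run. *)
Fixpoint run_marked g : bool :=
  if g is c :: g' then c.2 && (run_continues c g' ==> run_marked g') else true.

Lemma P4_cons c g : P4 (c :: g) <-> c.2 /\ (run_continues c g -> P4 g).
Proof.
split=> [Pg|[cm Pg] [|r] rg hb ha] //.
  split; first by apply: (Pg 0%N) => // i; rewrite leqn0 => /eqP->.
  case: g Pg => // c' g Pg /andP[/eqP bc ac] r rg hb ha.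
  apply: (Pg r.+1) => // -[|i] ir //; last exact: ha.
  by rewrite /= [lab_b _ _](hb i).
case: g Pg rg hb ha => // c' g Pg rg hb ha.
have bc : c'.1.2 = c.1.2 by apply: (hb 1%N).
apply: Pg => //; first by rewrite /run_continues bc eqxx; apply: (ha 0%N).
  by move=> i ir; have := hb i.+1 ir; rewrite -[lab_b (c :: _) 0]bc.
by move=> i ir; apply: (ha i.+1).
Qed.

Lemma run_markedP g : P4 g <-> run_marked g.
Proof.
elim: g => [|c g IH]; first by split.
rewrite P4_cons /=; split=> [[-> /=]|/andP[cm /implyP h]].
  by move=> h; apply/implyP => /h/IH.
by split => // /h/IH.
Qed.

(** Changes the mark of the last cover of the initial descending run: the one cover
    in that run for which both markings are compatible with the order. *)
Fixpoint toggle g : mchain :=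
  if g is c :: g' then
    if run_continues c g' then c :: toggle g' else (c.1, ~~ c.2) :: g'
  else [::].

Lemma run_continues_toggle c g : run_continues c (toggle g) = run_continues c g.
Proof. by case: g => //= c' g; case: ifP. Qed.

Lemma toggleK : involutive toggle.
Proof.
elim=> //= -[l m] g IH; case: ifP => h /=.
  by rewrite run_continues_toggle h IH.
by rewrite [run_continues _ g]h negbK.
Qed.

Lemma size_toggle g : size (toggle g) = size g.
Proof. by elim: g => //= c g IH; case: ifP => //= _; rewrite IH. Qed.

Lemma chain_end_toggle w g : chain_end w (toggle g) = chain_end w g.
Proof. by elim: g w => //= -[[a b] m] g IH w; case: ifP => //= _; rewrite IH. Qed.

Lemma run_marked_toggle g : g != [::] -> run_marked g ->
  nmarks g = (nmarks (toggle g)).+1 /\ ~~ run_marked (toggle g).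
Proof.
elim: g => // c g IH _ /= /andP[cm]; case: ifP => /= [h rm|h _].
  have [||nE nr] := IH => //; first by case: (g) h.
  by rewrite cm nE addnS run_continues_toggle h /= nr.
by rewrite cm.
Qed.

(** After an unmarked cover the rows of the same column must increase, so within a
    descending run every cover but the last is marked. *)
Lemma chain_ok_continues k w S lo b c g :
  chain_ok k w S lo b (c :: g) -> run_continues c g -> c.2.
Proof.
case: c => -[a b'] [] //= /and5P[_ _ _ _ /=]; case: g => // -[[a1 b1] m1] g /=.
by move=> /and5P[_ _ _ h _] /andP[/eqP bE aa]; move: h; rewrite bE ltnn eqxx /=; lia.
Qed.

Lemma toggle_run_marked k w S lo b g : chain_ok k w S lo b g -> ~~ run_marked g ->
  run_marked (toggle g).
Proof.
elim: g w S lo b => // c g IH w S lo b gok /=.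
have [h|h] := boolP (run_continues c g); last first.
  by rewrite /= andbT => ->; rewrite [run_continues _ g](negPf h).
rewrite (chain_ok_continues gok h) /= => rm.
rewrite (chain_ok_continues gok h) run_continues_toggle h /=.
by case: c gok {h} => -[a b'] m /= /and5P[_ _ _ _ /andP[_ /IH]]; apply.
Qed.

(** A mark may be added, because the rows of a descending run are distinct; it may be
    removed, because the next row in the same column, if any, is larger. *)
Lemma toggle_ok k w S lo b g :
  (if g is c :: _ then forall a, (a <= c.1.1)%N -> ~~ S a else True) ->
  chain_ok k w S lo b g -> chain_ok k w S lo b (toggle g).
Proof.
elim: g w S lo b => // -[[a b'] m] g IH w S lo b Sa /= gok.
have [h|h] := boolP (run_continues (a, b', m) g).
  case/and5P: gok => ak kb cab lob /andP[mS gok] /=.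
  rewrite ak kb cab lob mS /=; apply: IH => //.
  case: (g) h => // -[[a1 b1] m1] g' /= /andP[_ aa] c ca.
  by rewrite negb_or Sa /=; lia.
case/and5P: gok => ak kb cab lob /andP[mS gok] /=.
rewrite ak kb cab lob (Sa a) //= implybT.
case: g gok h {IH} => // -[[a1 b1] m1] g /= /and5P[-> -> /[dup] c1 -> h1 -> h] /=.
rewrite andbT; case: m h1 h {mS Sa} => /= h1 h; last by lia.
have [b1b|] := eqVneq b1 b'; last by lia.
have : a1 != a by apply: contraTneq c1 => ->; rewrite b1b cov_swap.
by move: h h1; rewrite b1b eqxx /=; lia.
Qed.

End InitialRun.

Section RunMarkedSums.

Variables (k : nat) (R : comNzRingType) (F : Sinf -> R).

Lemma perm_toggle w b : (k <= b)%N ->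
  perm_eq (map toggle (chain_list k k w no_row 0 b)) (chain_list k k w no_row 0 b).
Proof.
move=> kb; have tI := can_inj toggleK.
have tok g : chain_ok k w no_row 0 b g -> chain_ok k w no_row 0 b (toggle g).
  by apply: toggle_ok; case: g.
apply: uniq_perm; rewrite ?(map_inj_uniq tI) ?chain_list_uniq // => g.
rewrite -{1}(toggleK g) (mem_map tI) !chain_list_ok //.
by apply/idP/idP => [/tok|/tok //]; rewrite toggleK.
Qed.

Definition run_marked_sum w b p : R :=
  \sum_(g <- chain_list k k w no_row 0 b | (nmarks g == p) && run_marked g)
    chain_term F w p g.

(** Toggling pairs the chains with p marks that violate the condition on the
    initial run with those with p + 1 marks that satisfy it. *)
Lemma chain_sum_run_marked w b p : (k <= b)%N ->
  chain_sum k k F w no_row 0 b p =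
  run_marked_sum w b p - run_marked_sum w b p.+1.
Proof.
move=> kb; rewrite /chain_sum (bigID run_marked) /=; congr (_ + _).
rewrite /run_marked_sum -(perm_big _ (perm_toggle w kb)) big_map -sumrN /=.
rewrite big_seq_cond [RHS]big_seq_cond; apply: eq_big => g; last first.
  by move=> _; rewrite /chain_term size_toggle chain_end_toggle addnS exprS mulN1r mulNr opprK.
rewrite chain_list_ok //; case: (boolP (chain_ok _ _ _ _ _ g)) => //= gok.
have [->|gn] := eqVneq g [::]; first by rewrite andbF.
have [rm|rm] := boolP (run_marked g).
  by have [-> ->] := run_marked_toggle gn rm; rewrite eqSS.
by rewrite (toggle_run_marked gok rm) !andbF.
Qed.

Lemma run_marked_sum_large w b : exists N, forall p, (N <= p)%N -> run_marked_sum w b p = 0.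
Proof.
exists (\max_(g <- chain_list k k w no_row 0 b) (size g)).+1%N => p Np.
rewrite /run_marked_sum big_seq_cond big_pred0 // => g.
apply/negP => /andP[gL /andP[/eqP gp _]].
have /leq_ltn_trans/(_ Np) := leq_bigmax_seq (P := predT) (F := size) g gL isT.
by rewrite -gp ltnNge count_size.
Qed.

End RunMarkedSums.

(** * Chains from the identity and the theorem *)
Section ChainsFromIdentity.

Variable k : nat.

Lemma cycE j i : cyc k j i = cyc_fun k j i.
Proof. by []. Qed.

Lemma cyc0 : cyc k 0 = longest 0.
Proof.
apply: Sinf_ext => i; rewrite cycE -[longest 0 i]/(longest_fun 0 i).
by rewrite /cyc_fun /longest_fun; case_if; lia.
Qed.

Lemma swap_cyc j : (j < k)%N -> swap (cyc k j) (k - j.+1) k = cyc k j.+1.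
Proof.
move=> jk; apply: Sinf_ext => i; rewrite swapE !cycE /cyc_fun.
by case_transp; case_if; lia.
Qed.

(** The value at position k is k - j, and the positions before k hold the values
    0, ..., k - j - 1 followed by larger ones; only the last of the small values can
    move up to k - j without jumping. *)
Lemma cov_cyc j a : (j <= k)%N -> (a < k)%N ->
  cov (cyc k j) a k = (a + j.+1 == k)%N.
Proof.
move=> jk ak; have wk : cyc k j k = (k - j)%N.
  by rewrite cycE /cyc_fun ltnn andbF eqxx.
have wlo c : (c < k - j)%N -> cyc k j c = c.
  by move=> cj; rewrite cycE /cyc_fun; case_if; lia.
have whi c : (k - j <= c < k)%N -> cyc k j c = c.+1.
  by move=> cj; rewrite cycE /cyc_fun; case_if; lia.
apply/covP/eqP => [[_]|aj].
  rewrite wk; have [aj|ja] := ltnP a (k - j); last by rewrite whi; lia.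
  by rewrite wlo // => _ /(_ a.+1); have [?|?] := ltnP a.+1 (k - j); [rewrite wlo|]; lia.
rewrite wk wlo; last lia.
split => //; [lia|move=> c ack].
by rewrite whi; lia.
Qed.

Definition cycle_chain (j p : nat) : mchain :=
  [seq ((k - i.+1)%N, k, true) | i <- iota j p].

Lemma chain_ok_cyc_head j S lo c g : (j <= k)%N ->
  chain_ok k (cyc k j) S lo k (c :: g) ->
  [/\ (j < k)%N, c.1 = ((k - j.+1)%N, k)
    & chain_ok k (cyc k j.+1) (mark_used S c.1.1) (if c.2 then 0%N else c.1.1.+1) k g].
Proof.
move=> jk; case: c => -[a b] m /= /and5P[ak kb cab hb /andP[_ gok]].
have bk : b = k by lia.
subst b; move: cab; rewrite cov_cyc // => /eqP aj.
have aE : a = (k - j.+1)%N by lia.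
by subst a; rewrite swap_cyc in gok; [split => //; lia|lia].
Qed.

Lemma chain_ok_cyc j S lo g : (j <= k)%N -> chain_ok k (cyc k j) S lo k g ->
  run_marked g -> g = cycle_chain j (size g) /\ (j + size g <= k)%N.
Proof.
elim: g j S lo => [|c g IH] j S lo jk gok /=; first by rewrite addn0.
move=> /andP[cm /implyP rm].
have [jk' cE gok'] := chain_ok_cyc_head jk gok.
have [|gE gk] := IH _ _ _ jk' gok'.
  case: g gok' {IH gok} rm => // c1 g gok' rm; apply: rm.
  have [jk1 c1E _] := chain_ok_cyc_head jk' gok'.
  by rewrite /run_continues c1E cE /= eqxx; lia.
split; last by rewrite addnS -addSn.
rewrite /cycle_chain /= -[[seq _ | _ <- _]]/(cycle_chain j.+1 (size g)) -gE.
by congr (_ :: _); case: (c) cE cm => l m /= -> ->.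
Qed.

Lemma cycle_chain_ok j p S : (j + p <= k)%N ->
  (forall a, (a + j < k)%N -> ~~ S a) ->
  chain_ok k (cyc k j) S 0 k (cycle_chain j p).
Proof.
elim: p j S => [//|p IH] j S jp Sa.
have jk : (k - j.+1 < k)%N by lia.
rewrite /cycle_chain /= -[[seq _ | _ <- _]]/(cycle_chain j.+1 p).
rewrite jk leqnn cov_cyc ?Sa; [|lia..].
rewrite swap_cyc ?eqxx ?orbT /=; last by lia.
rewrite IH ?andbT; [lia|lia|].
by move=> a aj; rewrite negb_or Sa; lia.
Qed.

Lemma cycle_chain_end j p : (j + p <= k)%N ->
  chain_end (cyc k j) (cycle_chain j p) = cyc k (j + p).
Proof.
elim: p j => [|p IH] j jp; first by rewrite addn0.
rewrite /cycle_chain /= -[[seq _ | _ <- _]]/(cycle_chain j.+1 p).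
rewrite swap_cyc; last by lia.
by rewrite IH -?addSnnS; last lia.
Qed.

Lemma cycle_chain_marked j p : (j + p <= k)%N ->
  run_marked (cycle_chain j p) /\ nmarks (cycle_chain j p) = p.
Proof.
elim: p j => [//|p IH] j jp.
have [|rm nE] := IH j.+1; first by lia.
rewrite /cycle_chain /= -[[seq _ | _ <- _]]/(cycle_chain j.+1 p) rm implybT.
by rewrite nE add1n.
Qed.

Lemma size_cycle_chain j p : size (cycle_chain j p) = p.
Proof. by rewrite size_map size_iota. Qed.

(** Starting from the identity the covers are forced; the condition on the initial
    run forces the marks. *)
Lemma run_marked_sum_id (R : comNzRingType) (F : Sinf -> R) p : (p <= k)%N ->
  run_marked_sum k F (longest 0) k.+1 p = F (cyc k p).
Proof.
have fk : fixes_from k (longest 0) by apply: fixes_from_le (@longest_fixes 0).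
have okE g : chain_ok k (longest 0) no_row 0 k.+1 g = chain_ok k (cyc k 0) no_row 0 k g.
  rewrite -cyc0 in fk *; case: g => // -[[a b] m] g /=.
  case ak: (a < k)%N => //=; case kb: (k <= b)%N => //=.
  case cab: (cov _ a b) => //=; congr (_ && _).
  have [kb'|bk] := ltnP k b; first by rewrite (cov_fixed_far fk) in cab.
  by lia.
move=> pk; have [rm nE] := @cycle_chain_marked 0 p pk.
have gL : cycle_chain 0 p \in chain_list k k (longest 0) no_row 0 k.+1.
  by rewrite chain_list_ok // okE cycle_chain_ok.
rewrite /run_marked_sum big_mkcond (bigD1_seq _ gL) ?chain_list_uniq //=.
rewrite nE eqxx rm /= big1_seq ?addr0 => [|g /andP[gn]].
  by rewrite /chain_term size_cycle_chain -cyc0 cycle_chain_end // addnn -signr_odd odd_double mul1r.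
rewrite chain_list_ok // okE => gok; case: ifP => // /andP[/eqP gp rmg].
case/eqP: gn; have [gE gk] := chain_ok_cyc (leq0n k) gok rmg.
have [_ ng] := cycle_chain_marked gk.
by rewrite gE; congr cycle_chain; rewrite -gp {2}gE ng.
Qed.

End ChainsFromIdentity.

(** Two eventually vanishing sequences are determined by their differences. *)
Lemma telescope_unique (R : comNzRingType) (A B E : nat -> R) (c : R) :
  (forall p, E p * c = A p - A p.+1) -> (forall p, E p = B p - B p.+1) ->
  (exists N, forall p, (N <= p)%N -> A p = 0) ->
  (exists N, forall p, (N <= p)%N -> B p = 0) ->
  forall p, A p = c * B p.
Proof.
move=> EA EB [M AM] [N BN] p.
have [d] : exists d, (maxn M N <= p + d)%N by exists (maxn M N); lia.
elim: d p => [|d IH] p pd; first by rewrite AM ?BN ?mulr0 //; lia.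
have := EA p; rewrite EB (IH p.+1); last by lia.
by move=> H; rewrite -[A p](subrK (c * B p.+1)) -H; ring.
Qed.

Lemma run_marked_sum_Groth n k (v : Sinf) p : fixes_from n v -> (k <= n)%N ->
  (p <= k)%N ->
  run_marked_sum k Groth v n.+1 p = Groth v * Groth_1p p k.
Proof.
move=> vn kn pk; rewrite /Groth_1p -(run_marked_sum_id Groth pk).
have f0 : fixes_from k (longest 0) by apply: fixes_from_le (@longest_fixes 0).
apply: (telescope_unique (E := marking_poly x_ k)) => [q|q||].
- rewrite -(pieri_Groth q vn kn); apply: chain_sum_run_marked; lia.
- have := chain_sum_run_marked Groth (longest 0) q (leqnSn k).
  by rewrite (pieri_Groth q f0 (leqnn k)) Groth1 mulr1.
- exact: run_marked_sum_large.
- exact: run_marked_sum_large.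
Qed.

Lemma ell_chain_end k (v : Sinf) (g : mchain) : is_kchain k v g ->
  ell (chain_end v g) = (ell v + size g)%N.
Proof.
elim: g v => [|[[a b] m] g IH] v /=; first by rewrite addn0.
by move=> [[_ vab] /IH ->]; rewrite vab addSnnS.
Qed.

Theorem theorem12 (v : Sinf) (k p : nat) (hp : (1 <= p <= k)%N) :
  finite_set (Pieri_chains k p v) /\
  Groth v * Groth_1p p k =
    \sum_(g \in Pieri_chains k p v)
       (-1) ^+ (size g - p) * Groth (chain_end v g) /\
  (forall g g' : mchain,
     Pieri_chains k p v g -> Pieri_chains k p v g' ->
     chain_end v g = chain_end v g' ->
     (-1) ^+ (size g - p) = (-1) ^+ (size g' - p) :> int).
Proof.
have [n0 vn0] := Sinf_bound v; pose n := maxn n0 k.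
have vn : fixes_from n v by apply: fixes_from_le vn0; lia.
have kn : (k <= n)%N by lia.
pose L := [seq g <- chain_list k k v no_row 0 n.+1 | (nmarks g == p) && run_marked g].
have LE : Pieri_chains k p v = [set` L].
  apply/seteqP; split=> g /=.
    move=> [[ch [p1 p2 p3 /run_markedP p4]] gp].
    rewrite mem_filter gp eqxx p4 chain_list_ok //; last by lia.
    by apply/(chain_ok_start _ vn kn); split.
  rewrite mem_filter => /= /andP[/andP[/eqP gp /run_markedP p4]].
  rewrite chain_list_ok //; last by lia.
  by move=> /(chain_ok_start _ vn kn)[ch p1 p2 p3]; split.
have uL : uniq L by rewrite filter_uniq // chain_list_uniq //; lia.
split; first by rewrite LE; apply: finite_seq.
split; last first.
  move=> g g' [[ch _] _] [[ch' _] _] /(congr1 ell).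
  by rewrite (ell_chain_end ch) (ell_chain_end ch') => /addnI ->.
have pk : (p <= k)%N by case/andP: hp.
rewrite LE -fsbig_seq // -(run_marked_sum_Groth vn kn pk) /run_marked_sum -[LHS]big_filter.
rewrite [LHS]big_seq [RHS]big_seq; apply: eq_bigr => g; rewrite mem_filter /=.
move=> /andP[/andP[/eqP gp _] _]; rewrite /chain_term; congr (_ * _).
have pg : (p <= size g)%N by rewrite -gp count_size.
by rewrite -signr_odd -[in RHS]signr_odd oddB // oddD.
Qed.
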